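(* Let $0\le r\le p-1$. The functor $\mathcal M_\Sigma:\mathrm{Mod}_\Sigma^\varphi\to\mathrm{Mod}_S^\varphi$, $M\mapsto M\otimes_\Sigma S$ (with $\mathrm{Fil}^r(M\otimes_\Sigma S)$ the image of $\mathrm{Fil}^rM\otimes_\Sigma S+\mathrm{Fil}^rS\cdot(M\otimes_\Sigma S)$ and $\varphi_r$ the induced extension), is an equivalence of categories.
   Context: $p$ prime, $k$ perfect of characteristic $p$, $K_0=W(k)[1/p]$, $K/K_0$ totally ramified of degree $e$, $E(u)\in W(k)[u]$ the Eisenstein polynomial of a uniformizer. $S$ is the $p$-adic completion of the divided power envelope of $W(k)[u]$ w.r.t. $(E(u))$, $\mathrm{Fil}^jS$ the $p$-adic completion of the ideal generated by $E(u)^i/i!$ ($i\ge j$), $\varphi$ the Frobenius (arithmetic Frobenius on $W(k)$, $u\mapsto u^p$), $\varphi_r=p^{-r}\varphi$ on $\mathrm{Fil}^rS$, $c=\varphi(E(u))/p$. $\Sigma=W(k)[[Y]][u]/(E(u)^p-pY)\subset S$ via $Y\mapsto E(u)^p/p$; it is $\varphi$-stable, $\mathrm{Fil}^i\Sigma=\Sigma\cap\mathrm{Fil}^iS$, and $c\in\Sigma^\times$. For $A\in\{\Sigma,S\}$, $\mathrm{Mod}_A^\varphi$ is the category of triples $(M,\mathrm{Fil}^rM,\varphi_r)$: $M$ finite free over $A$, $\mathrm{Fil}^rA\cdot M\subseteq\mathrm{Fil}^rM\subseteq M$ an $A$-submodule, $\varphi_r:\mathrm{Fil}^rM\to M$ $\varphi$-semilinear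 with $\varphi_r(sx)=c^{-r}\varphi_r(s)\varphi_r(E(u)^rx)$ for $s\in\mathrm{Fil}^rA$, $x\in M$, $\varphi_r(\mathrm{Fil}^rM)$ generating $M$, and $M/\mathrm{Fil}^rM$ $p$-torsion free; morphisms are $A$-linear, preserve $\mathrm{Fil}^r$ and commute with $\varphi_r$. *)

(* Defs.v *)
From HB Require Import structures.
From mathcomp Require Import all_boot all_order all_algebra all_field qpoly.
From mathcomp Require Import boolp classical_sets.

Set Implicit Arguments.
Unset Strict Implicit.
Unset Printing Implicit Defensive.
Import GRing.Theory.
Local Open Scope ring_scope.

(* The quotient x / y: the z with z * y = x. It is only applied where such a z
   exists and is unique (y a unit, or a power of p in a p-torsion-free ring). *)
Definition exquo (A : comNzRingType) (x y : A) : A :=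
  xget 0 [set z | z * y = x]%classic.

Definition span_of (A : nzRingType) (V : lmodType A) (X : set V) : set V :=
  [set v | exists (n : nat) (a : 'I_n -> A) (x : 'I_n -> V),
     (forall i, X (x i)) /\ v = \sum_(i < n) a i *: x i]%classic.

Definition submodule (A : nzRingType) (V : lmodType A) (X : set V) : Prop :=
  X 0 /\ forall (a : A) (x y : V), X x -> X y -> X (a *: x + y).

Definition ideal_gen (A : comNzRingType) (X : set A) : set A :=
  @span_of A A^o X.

Definition semilinear_along (A B : nzRingType) (f : A -> B)
    (M : lmodType A) (N : lmodType B) (g : M -> N) : Prop :=
  (forall x y, g (x + y) = g x + g y) /\
  (forall a x, g (a *: x) = f a *: g x).

(* N, with j, is the tensor product of M and B over A, by its universal property *)
Definition is_base_change (A B : nzRingType) (f : A -> B)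
    (M : lmodType A) (N : lmodType B) (j : M -> N) : Prop :=
  semilinear_along f j /\
  forall (P : lmodType B) (g : M -> P), semilinear_along f g ->
    exists h : {linear N -> P}, (forall x, h (j x) = g x) /\
      forall h' : {linear N -> P}, (forall x, h' (j x) = g x) -> h' =1 h.

Definition pdvd (p n : nat) (V : zmodType) (x : V) : Prop :=
  exists y : V, x = y *+ (p ^ n).

Definition padic_complete (p : nat) (A : zmodType) : Prop :=
  (forall x : A, (forall n, pdvd p n x) -> x = 0) /\
  (forall u : nat -> A, (forall n, pdvd p n (u n.+1 - u n)) ->
     exists x, forall n, pdvd p n (x - u n)).

(* B = lim_n A/p^n, with f the canonical map: f identifies A/p^n with B/p^n for
   every n, and B = lim_n B/p^n *)
Definition is_padic_completion (p : nat) (A B : zmodType) (f : A -> B) : Prop :=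
  [/\ padic_complete p B,
      forall n (x : A), pdvd p n (f x) <-> pdvd p n x
    & forall n (y : B), exists x : A, pdvd p n (y - f x)].

(* The image in B of the p-adic completion lim_n I/p^n I of the subgroup I of A,
   where B is the p-adic completion of A along f *)
Definition completion_image (p : nat) (A B : zmodType) (f : A -> B) (I : set A) :
    set B :=
  [set x | exists u : nat -> A,
     [/\ forall n, I (u n),
         forall n, exists2 z, I z & u n.+1 - u n = z *+ (p ^ n)
       & forall n, pdvd p n (x - f (u n))]]%classic.

(* g n x is the n-th divided power of x; it is meaningful for x in I only *)
Definition pd_structure (A : comNzRingType) (I : set A) (g : nat -> A -> A) :
    Prop :=
  [/\ @submodule A A^o I,
      forall x, I x -> [/\ g 0%N x = 1, g 1%N x = x &
                           forall n, (0 < n)%N -> I (g n x)],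
      forall n x y, I x -> I y ->
        g n (x + y) = \sum_(i < n.+1) g i x * g (n - i)%N y,
      forall n a x, I x -> g n (a * x) = a ^+ n * g n x
    & (forall m n x, I x -> g m x * g n x = g (m + n)%N x *+ 'C(m + n, m)) /\
      (forall m n x, (0 < n)%N -> I x ->
        g m (g n x) = g (m * n)%N x *+ ((m * n)`! %/ (m`! * n`! ^ m)))].

Definition is_pd_envelope (A : comNzRingType) (I : set A)
    (D : comNzRingType) (J : set D) (g : nat -> D -> D) (f : {rmorphism A -> D}) :
    Prop :=
  [/\ pd_structure J g,
      forall x, I x -> J (f x)
    & forall (B : comNzRingType) (K : set B) (d : nat -> B -> B)
        (h : {rmorphism A -> B}),
        pd_structure K d -> (forall x, I x -> K (h x)) ->
        let extends (t : {rmorphism D -> B}) :=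
          [/\ forall x, t (f x) = h x, forall x, J x -> K (t x)
            & forall n x, J x -> t (g n x) = d n (t x)] in
        exists2 t : {rmorphism D -> B}, extends t &
          forall t' : {rmorphism D -> B}, extends t' -> t' =1 t].

Record fps (R : Type) := Fps { fps_coef : nat -> R }.

HB.instance Definition _ (R : Type) := gen_eqMixin (fps R).
HB.instance Definition _ (R : Type) := gen_choiceMixin (fps R).

Section FormalPowerSeries.
Context {R : comNzRingType}.
Implicit Types f g h : fps R.

Lemma fpsP f g : fps_coef f =1 fps_coef g -> f = g.
Proof. by case: f g => [f] [g] /= /funext ->. Qed.

Definition fps_add f g : fps R := Fps (fun n => fps_coef f n + fps_coef g n).
Definition fps_opp f : fps R := Fps (fun n => - fps_coef f n).
Definition fps_mul f g : fps R :=
  Fps (fun n => \sum_(i < n.+1) fps_coef f i * fps_coef g (n - i)%N).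
Definition fpsC (a : R) : fps R := Fps (fun n => a *+ (n == 0%N)).
Definition fpsY : fps R := Fps (fun n => (n == 1%N)%:R).

Fact fps_addA : associative fps_add.
Proof. by move=> f g h; apply: fpsP => n /=; rewrite addrA. Qed.
Fact fps_addC : commutative fps_add.
Proof. by move=> f g; apply: fpsP => n /=; rewrite addrC. Qed.
Fact fps_add0 : left_id (fpsC 0) fps_add.
Proof. by move=> f; apply: fpsP => n /=; rewrite mul0rn add0r. Qed.
Fact fps_addN : left_inverse (fpsC 0) fps_opp fps_add.
Proof. by move=> f; apply: fpsP => n /=; rewrite addNr mul0rn. Qed.

HB.instance Definition _ :=
  GRing.isZmodule.Build (fps R) fps_addA fps_addC fps_add0 fps_addN.

Let trunc n f : {poly R} := \poly_(i < n) fps_coef f i.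

Let coef_fps_mul N n f g : (n < N)%N ->
  fps_coef (fps_mul f g) n = (trunc N f * trunc N g)`_n.
Proof.
move=> nN; rewrite coefM /=; apply: eq_bigr => i _.
by rewrite !coef_poly (leq_ltn_trans _ nN) ?leq_ord// (leq_ltn_trans (leq_subr _ _) nN).
Qed.

Fact fps_mulA : associative fps_mul.
Proof.
move=> f g h; apply: fpsP => n.
pose F := trunc n.+1 f; pose G := trunc n.+1 g; pose H := trunc n.+1 h.
have -> : fps_coef (fps_mul f (fps_mul g h)) n = (F * (G * H))`_n.
  rewrite coefM /=; apply: eq_bigr => i _.
  rewrite coef_poly ltn_ord; congr (_ * _).
  by rewrite -(@coef_fps_mul n.+1) // ltnS leq_subr.
rewrite mulrA coefM /=; apply: eq_bigr => i _.
by rewrite [H`_ _]coef_poly ltnS leq_subr -(@coef_fps_mul n.+1).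
Qed.

Fact fps_mulC : commutative fps_mul.
Proof.
by move=> f g; apply: fpsP => n; rewrite !(@coef_fps_mul n.+1) // mulrC.
Qed.

Fact fps_mul1 : left_id (fpsC 1) fps_mul.
Proof.
move=> f; apply: fpsP => n /=; rewrite big_ord_recl /= mul1r subn0.
by rewrite big1 ?addr0 // => i _; rewrite mul0r.
Qed.

Fact fps_mulDl : left_distributive fps_mul +%R.
Proof.
move=> f g h; apply: fpsP => n /=; rewrite -big_split /=.
by apply: eq_bigr => i _; rewrite mulrDl.
Qed.

Fact fps_1neq0 : fpsC 1 != 0.
Proof.
by apply/eqP => /(congr1 (fun f => fps_coef f 0)) /eqP; rewrite /= oner_eq0.
Qed.

HB.instance Definition _ :=
  GRing.Zmodule_isComNzRing.Build (fps R)
    fps_mulA fps_mulC fps_mul1 fps_mulDl fps_1neq0.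

End FormalPowerSeries.

#[local] Obligation Tactic := idtac.

Record category := Category {
  obj :> Type;
  hom : obj -> obj -> Type;
  idm : forall X, hom X X;
  compose : forall X Y Z, hom Y Z -> hom X Y -> hom X Z;
  comp_idl : forall X Y (f : hom X Y), compose (idm Y) f = f;
  comp_idr : forall X Y (f : hom X Y), compose f (idm X) = f;
  compA : forall X Y Z T (h : hom Z T) (g : hom Y Z) (f : hom X Y),
    compose h (compose g f) = compose (compose h g) f
}.

Record functor (C D : category) := Functor {
  fobj :> C -> D;
  fmap : forall X Y : C, hom X Y -> hom (fobj X) (fobj Y);
  fmap_id : forall X : C, fmap (idm X) = idm (fobj X);
  fmap_comp : forall (X Y Z : C) (g : hom Y Z) (f : hom X Y),
    fmap (compose g f) = compose (fmap g) (fmap f)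
}.

Definition id_functor (C : category) : functor C C :=
  @Functor C C id (fun _ _ f => f) (fun=> erefl) (fun _ _ _ _ _ => erefl).

Program Definition comp_functor (C D E : category)
    (G : functor D E) (F : functor C D) : functor C E :=
  @Functor C E (fun X => G (F X)) (fun _ _ f => fmap G (fmap F f)) _ _.
Next Obligation. by move=> C D E G F X /=; rewrite !fmap_id. Qed.
Next Obligation. by move=> C D E G F X Y Z g f /=; rewrite !fmap_comp. Qed.

Definition natural (C D : category) (F G : functor C D)
    (t : forall X : C, hom (F X) (G X)) : Prop :=
  forall (X Y : C) (f : hom X Y), compose (t Y) (fmap F f) = compose (fmap G f) (t X).

Definition nat_isomorphic (C D : category) (F G : functor C D) : Prop :=
  exists (t : forall X : C, hom (F X) (G X)) (t' : forall X : C, hom (G X) (F X)),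
    [/\ natural t, natural t', forall X, compose (t' X) (t X) = idm (F X)
      & forall X, compose (t X) (t' X) = idm (G X)].

Definition equivalence (C D : category) (F : functor C D) : Prop :=
  exists G : functor D C,
    nat_isomorphic (comp_functor G F) (id_functor C) /\
    nat_isomorphic (comp_functor F G) (id_functor D).

(* A filtered ring with Frobenius, together with the element E(u) *)
Record filFrobRing := FilFrobRing {
  ff_ring :> comNzRingType;
  ffil : nat -> set ff_ring;
  ffrob : {rmorphism ff_ring -> ff_ring};
  fE : ff_ring
}.

Definition phir_ring (p r : nat) (A : filFrobRing) (s : A) : A :=
  exquo (ffrob A s) (p ^ r)%:R.

Definition c_of (p : nat) (A : filFrobRing) : A :=
  exquo (ffrob A (fE A)) p%:R.

(* vectType A is the type of finite free A-modules, A being any ring here. In the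
   axioms on phi_r, the membership in Fil^r M of a combination is
   carried by an element of the subtype with that underlying value. *)
Record filMod (p r : nat) (A : filFrobRing) := FilMod {
  fm_mod :> vectType A;
  fil : set fm_mod;
  phir : {x : fm_mod | fil x} -> fm_mod;
  fil_submod : submodule fil;
  fil_sub : forall (s : A) (x : fm_mod), ffil r s -> fil (s *: x);
  phir_semilin : forall (a : A) (x y z : {x : fm_mod | fil x}),
    sval z = a *: sval x + sval y -> phir z = ffrob A a *: phir x + phir y;
  phir_fil : forall (s : A) (x : fm_mod) (y z : {x : fm_mod | fil x}),
    ffil r s -> sval y = s *: x -> sval z = fE A ^+ r *: x ->
    phir y = exquo 1 (c_of p A ^+ r) *: (phir_ring p r s *: phir z);
  phir_gen : forall m : fm_mod,
    span_of [set n | exists x, n = phir x]%classic m;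
  fil_torsion : forall x : fm_mod, fil (x *+ p) -> fil x
}.

Definition is_filMod_hom (p r : nat) (A : filFrobRing) (M N : filMod p r A)
    (f : M -> N) : Prop :=
  [/\ linear f,
      forall x, fil x -> fil (f x)
    & forall (x : {x : M | fil x}) (y : {y : N | fil y}),
        sval y = f (sval x) -> phir y = f (phir x)].

Definition filMod_hom (p r : nat) (A : filFrobRing) (M N : filMod p r A) :=
  {f : M -> N | is_filMod_hom f}.

Program Definition filMod_id (p r : nat) (A : filFrobRing) (M : filMod p r A) :
    filMod_hom M M := exist _ id _.
Next Obligation.
move=> p r A M; split=> // -[x Hx] [y Hy] /= eyx.
by rewrite -eyx in Hx *; congr (phir (exist _ _ _)).
Qed.

Program Definition filMod_comp (p r : nat) (A : filFrobRing)
    (M N P : filMod p r A) (g : filMod_hom N P) (f : filMod_hom M N) :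
    filMod_hom M P := exist _ (fun x => sval g (sval f x)) _.
Next Obligation.
move=> p r A M N P [g [glin gfil gphi]] [f [flin ffl fphi]] /=; split.
- by move=> a x y; rewrite flin glin.
- by move=> x /ffl /gfil.
- move=> x y exy.
  rewrite (gphi (exist _ (f (sval x)) (ffl _ (svalP x))) y exy).
  by rewrite (fphi x (exist _ (f (sval x)) (ffl _ (svalP x)))).
Qed.

Fact filMod_homP (p r : nat) (A : filFrobRing) (M N : filMod p r A)
  (f g : filMod_hom M N) : sval f =1 sval g -> f = g.
Proof. by case: f g => [f Pf] [g Pg] /= /funext fg; apply: eq_exist. Qed.

Program Definition ModPhi (p r : nat) (A : filFrobRing) : category :=
  @Category (filMod p r A) (@filMod_hom p r A) (@filMod_id p r A)
    (@filMod_comp p r A) _ _ _.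
Next Obligation. by move=> *; apply: filMod_homP. Qed.
Next Obligation. by move=> *; apply: filMod_homP. Qed.
Next Obligation. by move=> *; apply: filMod_homP. Qed.

(* F is extension of scalars along iota, with canonical maps j_M : M -> F M; as F M is an object, phi_r on Fil^r F M is determined by its
   values on the j_M x with x in Fil^r M. *)
Definition is_scalar_extension (p r : nat) (A B : filFrobRing) (iota : A -> B)
    (F : functor (ModPhi p r A) (ModPhi p r B)) : Prop :=
  exists j : forall M : filMod p r A, M -> (F M : filMod p r B),
    [/\ forall M : filMod p r A, is_base_change iota (j M),
        forall (M : filMod p r A) (y : (F M : filMod p r B)), fil y <->
          exists a b : (F M : filMod p r B), [/\ y = a + b,
            span_of [set n | exists2 x, fil x & n = j M x]%classic a
          & span_of [set n | exists (s : B) (m : (F M : filMod p r B)),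
                       ffil r s /\ n = s *: m]%classic b],
        forall (M : filMod p r A) (x : {x : M | fil x}) (y : {y : (F M : filMod p r B) | fil y}),
          sval y = j M (sval x) -> phir y = j M (phir x)
      & forall (M N : ModPhi p r A) (f : hom M N) (x : M),
          sval (fmap F f) (j M x) = j N (sval f x)].

Definition perfect_of_char (p : nat) (k : fieldType) : Prop :=
  p \in [pchar k] /\ forall x : k, exists y : k, y ^+ p = x.

(* W is the ring of Witt vectors of the perfect field k of characteristic p, with
   res : W -> k the reduction: the strict p-ring with residue ring k *)
Definition is_witt_ring (p : nat) (k : fieldType) (W : idomainType)
    (res : {rmorphism W -> k}) : Prop :=
  [/\ p%:R != 0 :> W, padic_complete p W,
      forall x : k, exists w : W, res w = x
    & forall w : W, res w = 0 <-> pdvd p 1 w].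

Definition is_arith_frobenius (p : nat) (k : fieldType) (W : idomainType)
    (res : {rmorphism W -> k}) (sigma : {rmorphism W -> W}) : Prop :=
  forall w : W, res (sigma w) = res w ^+ p.

Section TotallyRamified.
Variables (p : nat) (W : idomainType) (K : fieldExtType {fraction W}).

Definition WtoK (w : W) : K := (tofrac w)%:A.

Definition integer_ring : set K := [set x | integralOver WtoK x]%classic.

Definition integer_unit : set K :=
  [set x | [/\ x != 0, integer_ring x & integer_ring x^-1]]%classic.

Definition uniformizer (pi : K) : Prop :=
  [/\ pi != 0, integer_ring pi
    & forall x, integer_ring x -> (integer_ring (x / pi) <-> ~ integer_unit x)].

Definition totally_ramified (e : nat) : Prop :=
  \dim {:K} = e /\
  exists2 pi, uniformizer pi & integer_unit (p%:R / pi ^+ e).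

Definition eisenstein (E : {poly W}) : Prop :=
  [/\ E \is monic, (1 < size E)%N,
      forall i, (i < (size E).-1)%N -> pdvd p 1 E`_i
    & ~ pdvd p 2 E`_0].

Definition eisenstein_poly_of (pi : K) (E : {poly W}) : Prop :=
  eisenstein E /\ map_poly WtoK E = minPoly 1%AS pi.

End TotallyRamified.

Definition principal (A : comNzRingType) (x : A) : set A :=
  [set y | exists a, y = a * x]%classic.

(* S is the p-adic completion, along cpl, of the divided power envelope
   (D, J, g) of (W[u], (E)), with inc : W[u] -> D the canonical map *)
Definition is_breuil_ring (p : nat) (W : idomainType) (E : {poly W})
    (D : comNzRingType) (J : set D) (g : nat -> D -> D)
    (inc : {rmorphism {poly W} -> D})
    (S : comNzRingType) (cpl : {rmorphism D -> S}) : Prop :=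
  is_pd_envelope (principal E) J g inc /\ is_padic_completion p cpl.

Definition FilS (p : nat) (W : idomainType) (E : {poly W})
    (D : comNzRingType) (g : nat -> D -> D) (inc : {poly W} -> D)
    (S : comNzRingType) (cpl : D -> S) (j : nat) : set S :=
  completion_image p cpl
    (ideal_gen [set x | exists2 i, (j <= i)%N & x = g i (inc E)]%classic).

Definition is_frobenius_S (p : nat) (W : idomainType) (S : comNzRingType)
    (ofWu : {poly W} -> S) (sigma : W -> W) (phi : S -> S) : Prop :=
  (forall w : W, phi (ofWu w%:P) = ofWu (sigma w)%:P) /\
  phi (ofWu 'X) = ofWu 'X ^+ p.

Definition sigma_modulus (p : nat) (W : idomainType) (E : {poly W}) :
    {poly fps W} :=
  map_poly fpsC E ^+ p - (p%:R * fpsY)%:P.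

Definition Sigma (p : nat) (W : idomainType) (E : {poly W}) : comNzRingType :=
  {poly %/ sigma_modulus p E}.

Definition toSigma (p : nat) (W : idomainType) (E : {poly W})
  (x : {poly fps W}) : Sigma p E := in_qpoly (sigma_modulus p E) x.

(* The inclusion of Sigma into S; a ring morphism with these values is unique, as
   E^(p n) / p^n tends to 0 in S *)
Definition is_Sigma_inclusion (p : nat) (W : idomainType) (E : {poly W})
    (S : comNzRingType) (ofWu : {poly W} -> S) (iota : Sigma p E -> S) : Prop :=
  [/\ injective iota,
      forall w : W, iota (toSigma p E (fpsC w)%:P) = ofWu w%:P,
      iota (toSigma p E 'X) = ofWu 'X
    & iota (toSigma p E fpsY%:P) = exquo (ofWu E ^+ p) p%:R].

(* Main.v *)
Require Import Defs.
From HB Require Import structures.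
From mathcomp Require Import all_boot all_order all_algebra all_field qpoly.
From mathcomp Require Import ring.
From mathcomp Require Import boolp classical_sets.

(* Write phi(x) = c^-r phi_r(E^r x), so that p^r phi_r = phi on Fil^r; since modules
   are p-torsion free, phi_r is determined by phi. The rings satisfy
   S = Sigma + Fil^p S, phi(S) <= Sigma and, because v_p(n!) <= n - (p - 1) for n >= p,
   phi(Fil^r S) <= p^r Sigma. Thus phi_r(Fil^p S . N) lies in the Sigma-span of phi(N),
   which gives the existence of the functor and full faithfulness.
   For essential surjectivity, let N be a module over S of rank d. Modulo
   (p, Fil^p S) the submodule Fil^r N comes from a k[u]-submodule of k[u]^d, hence has
   d generators; for lifts y_i in Fil^r N the e_i = phi_r(y_i) form a basis of N. With
   M the Sigma-span of the e_i and X the Sigma-span of phi_r(Fil^r N) one gets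
   X <= M + p X, hence X = M as Sigma is p-adically complete, and M with
   Fil^r M = M cap Fil^r N is the required object. *)

Set Implicit Arguments.
Unset Strict Implicit.
Unset Printing Implicit Defensive.
Import GRing.Theory.
Local Open Scope ring_scope.

(** The form of [N] over Sigma is intrinsic. Frobenius sends all of S into Sigma, and the Sigma-span
    of phi_r(Fil^r N) is M itself when N = M (x) S; hence every morphism over S preserves it, and
    essential surjectivity amounts to showing that this span is free of the right rank. The bound r
    <= p - 1 comes from n = p: there v_p(p!) = 1, and phi(E^p / p!) is a unit times p^(p-1). Two
    obstacles shape the proof. Division by p^r presupposes that S is p-torsion free, while S is
    given only through the universal property of the envelope; digits in base E and a map to the
    fraction field of W[u] settle this. Next, decomposing phi_r(z) leaves terms phi(f_l), for a
    basis f_l of N, and phi(f_l) = c^-r phi_r(E^r f_l) must be decomposed in turn. The recursion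
    closes because E^r f_l comes from W[u]^d, so that no further Fil^p term appears. *)

(** * Completeness for the powers of a ring element, and the units it produces *)

(** Completeness is expressed by series with explicit remainders: this form needs no
    torsion-freeness, passes to coordinates one at a time, and serves for [p] and for [Y] alike. *)
Definition adic (A : comNzRingType) (a : A) (V : lmodType A) : Prop :=
  (forall x : V, (forall n, exists y, x = a ^+ n *: y) -> x = 0) /\
  (forall u : nat -> V, exists x, forall n, exists y,
     x = \sum_(i < n) a ^+ i *: u i + a ^+ n *: y).

Lemma pdvdE (p n : nat) (A : comNzRingType) (V : lmodType A) (x : V) :
  pdvd p n x <-> exists y, x = p%:R ^+ n *: y.
Proof. by split=> -[y ->]; exists y; rewrite -natrX scaler_nat. Qed.

Lemma padic_adic (p : nat) (A : comNzRingType) (V : lmodType A) :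
  padic_complete p V -> adic p%:R V.
Proof.
move=> [sep cmp]; split=> [x xdvd|u].
  by apply: sep => n; apply/pdvdE.
have [|x xP] := cmp (fun n => \sum_(i < n) p%:R ^+ i *: u i).
  by move=> n; apply/pdvdE; exists (u n); rewrite big_ord_recr /= addrAC subrr add0r.
exists x => n; have /pdvdE[y yE] := xP n.
by exists y; rewrite -yE addrC subrK.
Qed.

Lemma adic_can (A : comNzRingType) (a : A) (V V' : lmodType A)
    (f : {linear V -> V'}) (f' : {linear V' -> V}) :
  cancel f f' -> cancel f' f -> adic a V -> adic a V'.
Proof.
move=> fK f'K [sep cmp]; split=> [x xdvd|u].
  rewrite -(f'K x) (sep (f' x)) ?linear0// => n.
  by have [y ->] := xdvd n; exists (f' y); rewrite linearZ.
have [x xP] := cmp (fun n => f' (u n)).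
exists (f x) => n; have [y ->] := xP n; exists (f y).
rewrite linearD linearZ /=; congr (_ + _); rewrite linear_sum.
by apply: eq_bigr => i _; rewrite linearZ f'K.
Qed.

Lemma adic_rV (A : comNzRingType) (a : A) (n : nat) :
  adic a A^o -> adic a 'rV[A]_n.
Proof.
move=> [sep cmp]; split=> [x xdvd|u].
  apply/rowP => j; rewrite mxE; apply: sep => m.
  by have [y ->] := xdvd m; exists (y 0 j); rewrite mxE.
have [x xP] := choice (fun j => cmp (fun m => u m 0 j)).
exists (\row_j x j) => m.
have [y yP] := choice (fun j => xP j m).
exists (\row_j y j); apply/rowP => j; rewrite !mxE yP summxE.
by congr (_ + _); apply: eq_bigr => i _; rewrite mxE.
Qed.

(** Trades a scalar for a ring element: completeness of Sigma as a module over [fps W] becomes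
    completeness of Sigma as a ring, where [adic_unit] applies. *)
Lemma adic_alg (A : comNzRingType) (a : A) (V : comAlgType A) :
  adic a V -> adic (a%:A : V) V^o.
Proof.
have scE n (y : V) : (a%:A ^+ n : V) * y = a ^+ n *: y.
  by rewrite exprZn expr1n mulr_algl.
move=> [sep cmp]; split=> [x xdvd|u].
  apply: sep => n; have [y ->] := xdvd n.
  by exists y; rewrite /GRing.scale /= scE.
have [x xP] := cmp u; exists x => n; have [y ->] := xP n; exists y.
rewrite /GRing.scale /= scE; congr (_ + _).
by apply: eq_bigr => i _; rewrite /GRing.scale /= scE.
Qed.

(* The inverse of [1 - a z] is the geometric series. *)
Lemma adic_unit (A : comNzRingType) (a : A) :
  adic a A^o -> forall z : A, exists y, y * (1 - a * z) = 1.
Proof.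
move=> [sep cmp] z; have [y yP] := cmp (fun n => z ^+ n).
exists y; apply/eqP; rewrite -subr_eq0; apply/eqP/sep => n.
have [t ->] := yP n; exists (t * (1 - a * z) - z ^+ n).
have -> : \sum_(i < n) a ^+ i *: (z ^+ i : A^o) = \sum_(i < n) (a * z) ^+ i.
  by apply: eq_bigr => i _; rewrite exprMn.
have geom : (\sum_(i < n) (a * z) ^+ i) * (1 - a * z) = 1 - (a * z) ^+ n.
  by rewrite mulrC -opprB mulNr -subrX1 opprB.
rewrite mulrDl geom exprMn /GRing.scale /=; ring.
Qed.

(** [1 - z] divides [1 - z ^+ n = 1 - a * b], which is a unit. *)
Lemma adic_unit_nil (A : comNzRingType) (a z : A) (n : nat) :
  adic a A^o -> (exists b, z ^+ n = a * b) -> exists y, y * (1 - z) = 1.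
Proof.
move=> /adic_unit ua [b zE]; have [y yE] := ua b.
exists (y * \sum_(i < n) z ^+ i).
by rewrite -mulrA [X in _ * X]mulrC -opprB mulNr -subrX1 zE opprB.
Qed.

(** By Bezout some multiple of [m] has the form 1 + b p, a unit by completeness. *)
Lemma padic_natr_unit (A : comNzRingType) (p m : nat) : (0 < m)%N ->
  coprime p m -> adic (p%:R : A) A^o -> exists y : A, y * m%:R = 1.
Proof.
move=> m_gt0 cop /adic_unit/(_ (- _)) uA.
have [a b ab _] := egcdnP p m_gt0; rewrite gcdnC (eqP cop) in ab.
have [y yE] := uA b%:R; exists (y * a%:R).
rewrite -mulrA -natrM ab natrD natrM addrC -[RHS]yE.
by rewrite mulrN opprK (mulrC b%:R).
Qed.

(** * Power series: completeness for constants and for Y *)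

Section FpsTheory.
Variable R : comNzRingType.
Implicit Types f : fps R.

Fact fpsC_is_zmod_morphism : zmod_morphism (@fpsC R).
Proof. by move=> a b; apply: fpsP => n /=; rewrite mulrnBl. Qed.

HB.instance Definition _ :=
  GRing.isZmodMorphism.Build R (fps R) (@fpsC R) fpsC_is_zmod_morphism.

Lemma fps_coefCM a f n : fps_coef (fpsC a * f) n = a * fps_coef f n.
Proof.
rewrite /= big_ord_recl /= mulr1n subn0 big1 ?addr0// => i _.
by rewrite mulr0n mul0r.
Qed.

Fact fpsC_is_monoid_morphism : monoid_morphism (@fpsC R).
Proof.
split=> // a b; apply: fpsP => n; rewrite fps_coefCM /=.
by rewrite mulrnAr.
Qed.

HB.instance Definition _ :=
  GRing.isMonoidMorphism.Build R (fps R) (@fpsC R) fpsC_is_monoid_morphism.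

Lemma fps_coefYM f n : fps_coef (fpsY * f) n = fps_coef f n.-1 *+ (0 < n).
Proof.
case: n => [|n] /=; first by rewrite big_ord_recl big_ord0 mul0r addr0.
rewrite big_ord_recl mul0r add0r big_ord_recl /= mul1r subSS subn0 big1 ?addr0//.
by move=> i _; rewrite mul0r.
Qed.

Lemma fps_coefYnM n f m : (m < n)%N -> fps_coef (fpsY ^+ n * f) m = 0.
Proof.
elim: n m => // n IHn m mn; rewrite exprS -mulrA fps_coefYM.
by case: m mn => //= m mn; rewrite IHn.
Qed.

Lemma fps_coefD f g n : fps_coef (f + g) n = fps_coef f n + fps_coef g n.
Proof. by []. Qed.

Lemma fps_coef_sum (I : Type) (r : seq I) (F : I -> fps R) n :
  fps_coef (\sum_(i <- r) F i) n = \sum_(i <- r) fps_coef (F i) n.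
Proof.
elim/big_rec2: _ => [|i x y _ <-]; first by rewrite /= mul0rn.
by rewrite fps_coefD.
Qed.

Lemma adic_fpsC (a : R) : adic a R^o -> adic (fpsC a) (fps R)^o.
Proof.
have scE n (f : (fps R)^o) m :
    fps_coef (fpsC a ^+ n *: f) m = a ^+ n *: (fps_coef f m : R^o).
  by rewrite -rmorphXn fps_coefCM.
move=> [sep cmp]; split=> [x xdvd|u].
  apply: fpsP => m; rewrite [RHS]mul0rn; apply: sep => n.
  by have [y ->] := xdvd n; exists (fps_coef y m); rewrite scE.
have [x xP] := choice (fun m => cmp (fun n => fps_coef (u n) m)).
exists (Fps x) => n; have [y yP] := choice (fun m => xP m n).
exists (Fps y); apply: fpsP => m; rewrite fps_coefD fps_coef_sum scE [LHS]yP.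
by congr (_ + _); apply: eq_bigr => i _; rewrite scE.
Qed.

Lemma adic_fpsY : adic fpsY (fps R)^o.
Proof.
split=> [x xdvd|u].
  apply: fpsP => m; have [y ->] := xdvd m.+1.
  by rewrite [RHS]mul0rn fps_coefYnM.
(* [s v] is the sum of the Y^i v_i; only the terms with i <= m reach degree m, so each coefficient
   is a finite sum. *)
pose s (v : nat -> fps R) : fps R :=
  Fps (fun m => \sum_(i < m.+1) fps_coef (v i) (m - i)).
have sS v : s v = v 0%N + fpsY * s (fun n => v n.+1).
  apply: fpsP => m; rewrite fps_coefD fps_coefYM /= big_ord_recl subn0.
  congr (_ + _); case: m => [|m] /=; first by rewrite big_ord0.
  by apply: eq_bigr => i _; rewrite /bump /= add1n subSS.
exists (s u) => n; exists (s (fun i => u (n + i)%N)).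
elim: n => [|n IHn]; first by rewrite big_ord0 add0r [RHS]mul1r.
rewrite IHn sS big_ord_recr /= addn0 -addrA; congr (_ + _).
rewrite scalerDr; congr (_ + _); rewrite exprSr -scalerA; congr (_ *: (_ * _)).
by apply: fpsP => m; apply: eq_bigr => i _; rewrite addnS.
Qed.

End FpsTheory.

Import VectorInternalTheory.

Lemma adic_vect (A : comNzRingType) (a : A) (V : vectType A) :
  adic a A^o -> adic a V.
Proof.
move=> /(@adic_rV _ _ (dim V)) H.
exact: (@adic_can A a 'rV_(dim V) V (@r2v _ V) (@v2r _ V) (@r2vK _ V) (@v2rK _ V)).
Qed.

(** * Completeness of Sigma for p and for Y *)

Section SigmaAdic.
Variables (p : nat) (W : idomainType) (E : {poly W}).

(** Sigma is free of finite rank over [fps W], so completeness is inherited coordinatewise. *)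
Lemma Sigma_adic_p : adic p%:R W^o -> adic p%:R (Sigma p E)^o.
Proof.
move=> /adic_fpsC; rewrite rmorph_nat => /(@adic_vect _ _ {poly %/ sigma_modulus p E}).
by move=> /adic_alg; rewrite scaler_nat.
Qed.

Lemma Sigma_adic_Y : adic (toSigma p E fpsY%:P) (Sigma p E)^o.
Proof.
have /(@adic_vect _ _ {poly %/ sigma_modulus p E})/adic_alg := @adic_fpsY W.
suff -> : fpsY%:A = toSigma p E fpsY%:P by [].
by rewrite /toSigma -alg_polyC in_qpolyZ in_qpoly1.
Qed.

End SigmaAdic.

(** * Linear generation of the divided power envelope *)

Section PdEnvelope.
Variables (R : comNzRingType) (E : R) (D : comNzRingType) (J : set D).
Variables (g : nat -> D -> D) (inc : {rmorphism R -> D}).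

(** Coefficients are taken in [R] only, so that products reduce to the binomial rule. Once
    [pd_envelope_span] is known, this is the ideal of [D] generated by the divided powers of index
    at least [N]. *)
Definition pdspan (N : nat) : set D :=
  [set x | exists2 s : seq (R * nat), all (fun t => N <= t.2)%N s &
     x = \sum_(t <- s) inc t.1 * g t.2 (inc E)]%classic.

Lemma pdspan_ind N (P : D -> Prop) :
  P 0 -> (forall x y, P x -> P y -> P (x + y)) ->
  (forall a i, (N <= i)%N -> P (inc a * g i (inc E))) ->
  forall x, pdspan N x -> P x.
Proof.
move=> P0 PD Pgen _ [s + ->]; elim: s => [|[a i] s IHs] /=; first by rewrite big_nil.
by case/andP=> Ni /IHs Ps; rewrite big_cons; apply: PD => //; apply: Pgen.
Qed.

Lemma pdspan0 N : pdspan N 0.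
Proof. by exists [::]; rewrite ?big_nil. Qed.

Lemma pdspanD N x y : pdspan N x -> pdspan N y -> pdspan N (x + y).
Proof.
move=> [s sN ->] [t tN ->]; exists (s ++ t); last by rewrite big_cat.
by rewrite all_cat sN.
Qed.

Lemma pdspan_gen N a i : (N <= i)%N -> pdspan N (inc a * g i (inc E)).
Proof. by move=> Ni; exists [:: (a, i)]; rewrite ?big_seq1 //= Ni. Qed.

Lemma pdspan_sum N (I : Type) (r : seq I) (P : pred I) (F : I -> D) :
  (forall i, P i -> pdspan N (F i)) -> pdspan N (\sum_(i <- r | P i) F i).
Proof.
move=> FN; elim/big_rec: _ => [|i x Pi]; first exact: pdspan0.
exact/pdspanD/FN.
Qed.

Hypothesis env : is_pd_envelope (principal E) J g inc.

Let Jy : J (inc E).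
Proof. by case: env => _ + _; apply; exists 1; rewrite mul1r. Qed.

Let gM m n x : J x -> g m x * g n x = g (m + n)%N x *+ 'C(m + n, m).
Proof. by case: env => -[_ _ _ _ [gM _]] _ _; apply: gM. Qed.

Let inc_id a : pdspan 0 (inc a).
Proof.
case: env => -[_ /(_ _ Jy)[g0 _ _] _ _ _] _ _.
by rewrite -[inc a]mulr1 -g0; apply: pdspan_gen.
Qed.

Lemma pdspanM N x y : pdspan N x -> pdspan 0 y -> pdspan N (x * y).
Proof.
move=> + y0; move: x; apply: pdspan_ind => [|x x' xN x'N|a i Ni].
- by rewrite mul0r; apply: pdspan0.
- by rewrite mulrDl; apply: pdspanD.
move: y y0; apply: pdspan_ind => [|x x' xN x'N|b j _].
- by rewrite mulr0; apply: pdspan0.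
- by rewrite mulrDr; apply: pdspanD.
rewrite mulrACA gM// -rmorphM mulrnAr -mulrnAl -rmorphMn.
by apply: pdspan_gen; rewrite (leq_trans Ni) ?leq_addr.
Qed.

(** Sums go through the addition rule, in which every term has a factor of positive index when n >
    0; on a generator, g_n(a g_i) = a^n g_n(g_i) is an integer multiple of a^n g_(ni). *)
Lemma pdspan_pd x : pdspan 1 x ->
  J x /\ forall n, pdspan 0 (g n x) /\ ((0 < n)%N -> pdspan 1 (g n x)).
Proof.
case: env => -[[J0 Jlin] Jg gD gZ [_ gg]] _ _.
move: x; apply: pdspan_ind => [|x y [Jx gx] [Jy' gy]|a i i1].
- split=> // n; have [g0 _ _] := Jg _ J0.
  case: n => [|n]; first by rewrite g0 -(rmorph1 inc).
  by rewrite -(mulr0 0) gZ// expr0n mul0r; split=> *; apply: pdspan0.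
- split=> [|n]; first by have := Jlin 1 _ _ Jx Jy'; rewrite scale1r.
  rewrite gD//; split=> [|n0]; apply: pdspan_sum => j _.
    by apply: pdspanM; [apply: (gx _).1|apply: (gy _).1].
  case: (posnP j) => [-> | j0].
    rewrite subn0 mulrC; apply: pdspanM; first exact: (gy n).2.
    exact: (gx _).1.
  by apply: pdspanM; [apply: (gx _).2|apply: (gy _).1].
have [_ _ Jgn] := Jg _ Jy; have Jgi := Jgn _ i1.
split=> [|n].
  by have := Jlin (inc a) _ _ Jgi J0; rewrite addr0.
have pdN N : (N <= n * i)%N -> pdspan N (g n (inc a * g i (inc E))).
  move=> Nni; rewrite gZ// gg// -rmorphXn mulrnAr -mulrnAl -rmorphMn.
  exact: pdspan_gen.
by split=> [|n0]; apply: pdN; rewrite // muln_gt0 n0.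
Qed.

Let B := fun x : D => `[< pdspan 0 x >].

Let B_subring : subring_closed B.
Proof.
have BN x : pdspan 0 x -> pdspan 0 (- x).
  by rewrite -mulrN1 -(rmorphN1 inc) => xB; apply: pdspanM.
split=> [|x y|x y]; rewrite !unfold_in.
- by apply/asboolP; rewrite -(rmorph1 inc).
- by move=> /asboolP xB /asboolP yB; apply/asboolP/pdspanD/BN.
- by move=> /asboolP xB /asboolP yB; apply/asboolP/pdspanM.
Qed.

HB.instance Definition _ := GRing.isSubringClosed.Build D B B_subring.

Record subD := SubD { subD_val : D; subD_valP : B subD_val }.
HB.instance Definition _ := [isSub for subD_val].
HB.instance Definition _ := [Choice of subD by <:].
HB.instance Definition _ := [SubChoice_isSubComNzRing of subD by <:].

Let incB (a : R) : subD := SubD (asboolT (inc_id a)).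

Let incB_zmod : zmod_morphism incB.
Proof. by move=> a b; apply: val_inj; rewrite /= rmorphB. Qed.

Let incB_monoid : monoid_morphism incB.
Proof.
by split=> [|a b]; apply: val_inj; rewrite /= ?rmorph1 ?rmorphM.
Qed.

HB.instance Definition _ := GRing.isZmodMorphism.Build R subD incB incB_zmod.
HB.instance Definition _ := GRing.isMonoidMorphism.Build R subD incB incB_monoid.

(* The span of the divided powers of [E] is a sub-PD-ring of the envelope; by
   uniqueness, the retraction given by the universal property is the identity. *)
Lemma pd_envelope_span x : pdspan 0 x.
Proof.
pose K : set subD := fun b => pdspan 1 (val b).
(* Off [K] the divided power may leave the subring, and then [insubd] returns its default 0; the
   axioms only look at [K]. *)
pose d n (b : subD) : subD := insubd 0 (g n (val b)).
have dE n b : K b -> val (d n b) = g n (val b).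
  by case/pdspan_pd=> _ gb; rewrite insubdK// unfold_in; apply/asboolP/(gb n).1.
case: (env) => -[[J0 Jlin] Jg gD gZ [gMM gg]] incJ univ.
have pdK : pd_structure K d.
  have KJ b : K b -> J (val b) by case/pdspan_pd.
  have [K0 KD KM] : [/\ K 0, forall x y, K x -> K y -> K (x + y)
      & forall a x, K x -> K (a * x)].
    split=> [|b c|a b]; rewrite /K.
    - by rewrite rmorph0; apply: pdspan0.
    - by rewrite rmorphD; apply: pdspanD.
    - by rewrite rmorphM mulrC => bK; apply: pdspanM => //; apply/asboolP/(valP a).
  have Kd n b : (0 < n)%N -> K b -> K (d n b).
    by move=> n0 Kb; rewrite /K dE//; case/pdspan_pd: Kb => _ /(_ n)[_]; apply.
  split; first by split=> // a b c Kb Kc; apply/KD/Kc/KM.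
  - move=> b Kb; have [g0 g1 _] := Jg _ (KJ _ Kb).
    split=> [||n n0]; try by apply: val_inj; rewrite dE.
    exact: Kd.
  - move=> n b c Kb Kc; apply: val_inj.
    rewrite dE ?rmorphD ?gD ?rmorph_sum//; try exact: KJ; last exact: KD.
    by apply: eq_bigr => i _; rewrite rmorphM /= !dE.
  - move=> n a b Kb; apply: val_inj.
    rewrite dE ?rmorphM ?gZ ?rmorphXn//; [|exact: KJ|exact: KM].
    by rewrite -[X in _ = _ * X]/(val (d n b)) dE.
  - split=> [m n b Kb|m n b n0 Kb]; apply: val_inj.
      by rewrite rmorphM rmorphMn /= !dE ?gMM//; exact: KJ.
    by rewrite rmorphMn /= !dE ?gg//; [exact: KJ|exact: Kd].
have [|t [tinc tK td] _] := univ subD K d incB pdK.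
  move=> _ [a ->]; rewrite /K /= rmorphM mulrC; apply: pdspanM => //.
  have [_ g1 _] := Jg _ Jy; rewrite -[inc E]g1 -[g 1 _]mul1r -(rmorph1 inc).
  exact: pdspan_gen.
have [|t0 _ t0_uniq] := univ D J g inc _ incJ; first by case: env.
have [idE valE] : idfun x = t0 x /\ val (t x) = t0 x.
  split; first exact: t0_uniq.
  apply: (t0_uniq (\val \o t)).
  split=> [a|b Jb|n b Jb] /=; first by rewrite tinc.
    by have /pdspan_pd[] := tK _ Jb.
  by rewrite td// dE//; apply: tK.
have -> : x = val (t x) by rewrite valE -[LHS]/(idfun x).
exact/asboolP/(valP (t x)).
Qed.

End PdEnvelope.

(** * Torsion-freeness of the envelope *)

(** The quotient counts the partitions of a set of m n elements into m blocks of size n. Its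
    integrality is needed because the axiom on [g m (g n x)] is written with truncated division. *)
Lemma dvdn_fact_pow (m n : nat) : (0 < n)%N -> (m`! * n`! ^ m %| (m * n)`!)%N.
Proof.
case: n => // n _; elim: m => [|m IHm]; first by rewrite mul0n.
set N := n.+1 in IHm *; have le : (N <= m.+1 * N)%N by rewrite mulSn leq_addr.
rewrite -(bin_fact le) mulSn addKn.
have -> : 'C(N + m * N, N) = (m.+1 * 'C((N + m * N).-1, n))%N.
  apply/eqP; rewrite -(eqn_pmul2l (ltn0Sn n)) -mul_bin_diag.
  by rewrite mulnA [(n.+1 * m.+1)%N]mulnC -mulSn.
rewrite factS expnS; move: N`! (fact_gt0 N) ('C(_, _)) (m * N)`! IHm => f f0 c P fP.
have -> : (m.+1 * m`! * (f * f ^ m) = m.+1 * f * (m`! * f ^ m))%N by rewrite mulnACA.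
have -> : (m.+1 * c * (f * P) = m.+1 * f * (c * P))%N by rewrite mulnACA.
by rewrite dvdn_mul// dvdn_mull.
Qed.

Lemma dvdn_fact_fact (m n : nat) : (m <= n)%N -> (m`! %| n`!)%N.
Proof. by move=> mn; rewrite -(bin_fact mn) mulnCA dvdn_mulr. Qed.

Section FieldPd.
Variables (F : fieldType) (F0 : forall n, (0 < n)%N -> n%:R != 0 :> F).

(** In characteristic zero the unit ideal of a field has divided powers; this is the target in which
    torsion of the envelope is detected. *)
Lemma field_pd_structure :
  @pd_structure F setT (fun n (x : F) => x ^+ n / n`!%:R).
Proof.
have f0 n : n`!%:R != 0 :> F by apply: F0; apply: fact_gt0.
split=> //.
- by move=> x _; split; rewrite ?expr0 ?expr1 ?divr1.
- move=> n x y _ _; rewrite addrC exprDn mulr_suml; apply: eq_bigr => i _.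
  have le : (i <= n)%N by rewrite -ltnS.
  rewrite -(bin_fact le) !natrM -mulr_natr.
  have C0 : 'C(n, i)%:R != 0 :> F by apply: F0; rewrite bin_gt0.
  by field; rewrite C0 !f0.
- by move=> n a x _; rewrite exprMn mulrA.
split=> [m n x _|m n x n0 _].
  have le : (m <= m + n)%N by rewrite leq_addr.
  rewrite -(bin_fact le) addKn -mulr_natr !natrM exprD.
  have C0 : 'C(m + n, m)%:R != 0 :> F by apply: F0; rewrite bin_gt0.
  by field; rewrite C0 !f0.
have [q qE] := dvdnP (dvdn_fact_pow m n0).
have q0 : q%:R != 0 :> F.
  apply: F0; rewrite lt0n; apply/eqP => q0; have := fact_gt0 (m * n).
  by rewrite qE q0 mul0n.
rewrite qE mulnK ?muln_gt0 ?expn_gt0 ?fact_gt0// -[RHS]mulr_natr !natrM natrX.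
rewrite exprMn exprVn -exprM [(n * m)%N]mulnC.
have := expf_neq0 m (f0 n); move: (_ ^+ m) (x ^+ _) => A X A0.
by field; rewrite q0 A0 f0.
Qed.

End FieldPd.

Section PdTorsion.
Variables (W : idomainType) (E : {poly W}) (D : comNzRingType) (J : set D).
Variables (g : nat -> D -> D) (inc : {rmorphism {poly W} -> D}).
Hypotheses (W0 : forall n, (0 < n)%N -> n%:R != 0 :> W).
Hypotheses (E_monic : E \is monic) (sE1 : (1 < size E)%N)
  (env : is_pd_envelope (principal E) J g inc).

Let mulrn_poly0 (a : {poly W}) m : (0 < m)%N -> a *+ m = 0 -> a = 0.
Proof.
move=> m0 /eqP; rewrite -mulr_natr mulf_eq0 => /orP[/eqP//|].
by rewrite -polyC_natr polyC_eq0 (negPf (W0 m0)).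
Qed.

(** Uniqueness of digits in base [E]: the lowest digit equals - E Q, and a nonzero E Q would be at
    least as long as [E]. *)
Lemma monic_expansion0 n (a : nat -> {poly W}) :
  (forall i, size (a i) < size E)%N -> \sum_(i < n) a i * E ^+ i = 0 ->
  forall i, (i < n)%N -> a i = 0.
Proof.
elim: n a => // n IHn a aE; rewrite big_ord_recl expr0 mulr1.
pose Q := \sum_(i < n) a i.+1 * E ^+ i.
have -> : \sum_(i < n) a (lift ord0 i) * E ^+ lift ord0 i = E * Q.
  by rewrite mulr_sumr; apply: eq_bigr => i _; rewrite mulrCA exprS.
move=> aQ0; have Q0 : Q = 0.
  apply/eqP; apply: contraTT (aE 0%N) => Q0.
  move/eqP: aQ0; rewrite addr_eq0 => /eqP ->.
  rewrite size_polyN size_monicM// -leqNgt -subn1 -addnBA ?leq_addr//.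
  by rewrite size_poly_gt0.
move: aQ0; rewrite Q0 mulr0 addr0 => a0 [|i] //.
exact: (IHn (fun i => a i.+1)).
Qed.

(** Asking for equality at every [N >= n] lets two expansions be padded to a common length. *)
Let NF (x : D) := exists (a : nat -> {poly W}) (n : nat),
  (forall i, size (a i) < size E)%N /\
  forall N, (n <= N)%N -> x = \sum_(i < N) inc (a i) * g i (inc E).

(** Division by [E] shortens the coefficient, since q E g_i = (i + 1) q g_(i+1); the integer factor
    i + 1 is treated as a repeated sum. *)
Let NF_all x : NF x.
Proof.
have sE : (0 < size E)%N by rewrite size_poly_gt0 monic_neq0.
have NFD x' y : NF x' -> NF y -> NF (x' + y).
  move=> [a [n [aE xE]]] [b [m [bE yE]]].
  exists (fun i => a i + b i), (maxn n m); split=> [i|N].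
    by rewrite (leq_ltn_trans (size_polyD _ _))// gtn_max aE bE.
  rewrite geq_max => /andP[nN mN]; rewrite (xE N)// (yE N)// -big_split.
  by apply: eq_bigr => i _; rewrite rmorphD mulrDl.
move: x (pd_envelope_span env x); apply: pdspan_ind => //.
  exists (fun=> 0), 0%N; split=> [i|N _]; rewrite ?size_poly0//.
  by rewrite big1// => i _; rewrite rmorph0 mul0r.
move=> a i _; have [m] := ubnP (size a).
elim: m a i => // m IHm a i; rewrite ltnS => am.
rewrite (Pdiv.RingMonic.rdivp_eq E_monic a) rmorphD mulrDl; apply: (NFD); last first.
  exists (fun j => if j == i then Pdiv.Ring.rmodp a E else 0), i.+1.
  split=> [j|N iN].
    case: eqP => // _; last by rewrite size_poly0.
    by rewrite Pdiv.Ring.ltn_rmodp monic_neq0.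
  rewrite (bigD1 (Ordinal iN)) //= eqxx big1 ?addr0// => j /eqP ji.
  case: eqP => [jE|]; last by rewrite rmorph0 mul0r.
  by case: ji; apply: val_inj.
case: (env) => -[_ Jg _ _ [gM _]] incJ _.
have Jy : J (inc E) by apply: incJ; exists 1; rewrite mul1r.
have [_ g1 _] := Jg _ Jy.
rewrite rmorphM -mulrA -{1}g1 gM// add1n bin1 mulrnAr.
have NF0 : NF 0.
  exists (fun=> 0), 0%N; split=> [j|N _]; rewrite ?size_poly0//.
  by rewrite big1// => j _; rewrite rmorph0 mul0r.
set q := Pdiv.Ring.rdivp a E; elim: {2}i.+1 => [|j IHj]; first by rewrite mulr0n.
rewrite mulrS; apply: (NFD) => //.
have [q0|q0] := eqVneq q 0; first by rewrite q0 rmorph0 mul0r.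
apply: (IHm); apply: leq_trans am; rewrite ltnNge; apply/negP => qa.
have := size_polyD a (- Pdiv.Ring.rmodp a E); rewrite size_polyN.
rewrite {1}(Pdiv.RingMonic.rdivp_eq E_monic a) addrK size_Mmonic// leqNgt gtn_max.
have qE : (size q < (size q + size E).-1)%N.
  by rewrite -subn1 -addnBA// -[X in (X < _)%N]addn0 ltn_add2l subn_gt0.
rewrite (leq_ltn_trans qa qE) (@leq_trans (size E)) ?Pdiv.Ring.ltn_rmodp ?monic_neq0//.
by rewrite -subn1 addnC -addnBA ?leq_addr// size_poly_gt0.
Qed.

(** The universal property sends [D] to the fraction field of W[u], with g_i(E) going to E^i / i!. A
    torsion element dies there; clearing denominators by m! gives a vanishing expansion in base [E]
    with digits a_i m!/i!, so all a_i are zero. *)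
Lemma pd_envelope_torsion_free n (x : D) : (0 < n)%N -> x *+ n = 0 -> x = 0.
Proof.
have F0 m : (0 < m)%N -> m%:R != 0 :> {fraction {poly W}}.
  move=> m0; rewrite -(rmorph_nat (@tofrac _)) tofrac_eq0 -polyC_natr polyC_eq0.
  exact: W0.
have [//|t [tinc _ tg] _] := (let: And3 _ _ univ := env in univ)
  _ _ _ (@tofrac {poly W}) (field_pd_structure F0).
have Jy : J (inc E) by case: env => _ + _; apply; exists 1; rewrite mul1r.
move=> n0 xn0; have [a [m [aE /(_ m (leqnn m)) xE]]] := NF_all x.
have tx : t x = 0.
  have /eqP : t x *+ n = 0 by rewrite -rmorphMn xn0 rmorph0.
  by rewrite -mulr_natr mulf_eq0 (negPf (F0 _ n0)) orbF => /eqP.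
(* The factor 1 for [i >= m] is a filler that keeps every [b i] shorter than [E]. *)
pose b i := a i *+ (if (i < m)%N then (m`! %/ i`!)%N else 1%N).
have b0 i : (i < m)%N -> b i = 0.
  apply: monic_expansion0 => [j|].
    apply: leq_ltn_trans (aE j); rewrite /b -scaler_nat; exact: size_scale_leq.
  apply/eqP; rewrite -tofrac_eq0; apply/eqP.
  transitivity (t x * m`!%:R); last by rewrite tx mul0r.
  rewrite xE !rmorph_sum mulr_suml; apply: eq_bigr => j _.
  have [q qE] := dvdnP (dvdn_fact_fact (ltnW (ltn_ord j))).
  have tE : t (inc (a j) * g j (inc E)) =
      tofrac (a j) * (tofrac E ^+ j / j`!%:R) by rewrite rmorphM tg// !tinc.
  have bE : tofrac (b j * E ^+ j) = tofrac (a j) * q%:R * tofrac E ^+ j.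
    by rewrite rmorphM rmorphXn /b ltn_ord qE mulnK ?fact_gt0// rmorphMn mulr_natr.
  rewrite tE [LHS]bE qE natrM; have := F0 _ (fact_gt0 j).
  move: (j`!%:R) (q%:R) (tofrac _) (_ ^+ j) => f q' a' e f0.
  by rewrite [q' * f]mulrC !mulrA mulfVK// mulrAC.
rewrite xE big1// => i _; have := b0 i (ltn_ord i).
rewrite /b ltn_ord => /mulrn_poly0 ->; first by rewrite rmorph0 mul0r.
by rewrite divn_gt0 ?fact_gt0// dvdn_leq ?fact_gt0// dvdn_fact_fact// ltnW.
Qed.

End PdTorsion.

(** * Spans and p-adic approximation *)

Section Span.
Variables (A : nzRingType) (V : lmodType A) (X : set V).

Lemma span_of_gen x : X x -> span_of X x.
Proof.
by move=> Xx; exists 1%N, (fun=> 1), (fun=> x); rewrite big_ord1 scale1r.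
Qed.

Lemma span_of0 : span_of X 0.
Proof.
by exists 0%N, (fun=> 0), (fun=> 0); split=> [[]|]; rewrite ?big_ord0.
Qed.

Lemma span_ofD x y : span_of X x -> span_of X y -> span_of X (x + y).
Proof.
move=> [m [a [u [Xu ->]]]] [n [b [v [Xv ->]]]].
exists (m + n)%N, (fun i => match split i with inl j => a j | inr j => b j end),
  (fun i => match split i with inl j => u j | inr j => v j end).
split=> [i|]; first by case: split => j.
rewrite big_split_ord; congr (_ + _); apply: eq_bigr => i _.
  by rewrite (unsplitK (inl _)).
by rewrite (unsplitK (inr _)).
Qed.

Lemma span_ofZ a x : span_of X x -> span_of X (a *: x).
Proof.
move=> [m [b [u [Xu ->]]]]; exists m, (fun i => a * b i), u; split=> //.
by rewrite scaler_sumr; apply: eq_bigr => i _; rewrite scalerA.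
Qed.

Lemma span_of_sum (I : Type) (r : seq I) (F : I -> V) :
  (forall i, span_of X (F i)) -> span_of X (\sum_(i <- r) F i).
Proof.
by move=> XF; elim/big_rec: _ => [|i x _]; [apply: span_of0|apply: span_ofD].
Qed.

Lemma span_of_ind (P : V -> Prop) :
  P 0 -> (forall x y, P x -> P y -> P (x + y)) ->
  (forall a x, X x -> P (a *: x)) -> forall x, span_of X x -> P x.
Proof.
move=> P0 PD PX _ [m [a [u [Xu ->]]]].
by elim/big_rec: _ => // i x _; apply: PD; apply: PX.
Qed.

End Span.

Section Pdvd.
Variable p : nat.

Lemma pdvd0 n (V : zmodType) : pdvd p n (0 : V).
Proof. by exists 0; rewrite mul0rn. Qed.

Lemma pdvdD n (V : zmodType) (x y : V) : pdvd p n x -> pdvd p n y -> pdvd p n (x + y).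
Proof. by move=> [a ->] [b ->]; exists (a + b); rewrite mulrnDl. Qed.

Lemma pdvdN n (V : zmodType) (x : V) : pdvd p n x -> pdvd p n (- x).
Proof. by move=> [a ->]; exists (- a); rewrite mulNrn. Qed.

Lemma pdvd_exp n (V : zmodType) (x : V) : pdvd p n (x *+ p ^ n).
Proof. by exists x. Qed.

Lemma pdvd_raddf n (U V : zmodType) (f : {additive U -> V}) x :
  pdvd p n x -> pdvd p n (f x).
Proof. by move=> [a ->]; exists (f a); rewrite raddfMn. Qed.

Lemma pdvdW m n (V : zmodType) (x : V) : (m <= n)%N -> pdvd p n x -> pdvd p m x.
Proof.
by move=> mn [y ->]; exists (y *+ p ^ (n - m)); rewrite -mulrnA -expnD subnK.
Qed.

Lemma padic_series (U : zmodType) (u : nat -> U) : padic_complete p U ->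
  exists x, forall n, pdvd p n (x - \sum_(i < n) u i *+ p ^ i).
Proof.
case=> _; apply=> n; rewrite big_ord_recr /= addrAC subrr add0r.
exact: pdvd_exp.
Qed.

Lemma adic_padic (A : comNzRingType) (V : lmodType A) :
  adic (p%:R : A) V -> padic_complete p V.
Proof.
move=> [sep cmp]; split=> [x xdvd|u udvd].
  by apply: sep => n; apply/pdvdE.
have [v vP] := choice udvd; have [x xP] := cmp v.
exists (x + u 0%N) => n; have [y ->] := xP n; exists y.
suff -> : u n = \sum_(i < n) p%:R ^+ i *: v i + u 0%N.
  by rewrite opprD addrACA subrr addr0 addrAC subrr add0r -natrX scaler_nat.
elim: n => [|n IHn]; first by rewrite big_ord0 add0r.
rewrite big_ord_recr /= -addrA [_ + u _]addrC addrA -IHn.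
by rewrite -natrX scaler_nat -vP addrC subrK.
Qed.

(* Iterating [x = f a + p x'] expands [x] as [f a_0 + p f a_1 + p^2 f a_2 + ...]. *)
Lemma padic_expansion (U V : zmodType) (P : set V) (X : set U) (f : U -> V) :
  (forall x, P x -> exists a x', [/\ X a, P x' & x = f a + x' *+ p]) ->
  forall x, P x -> exists u : nat -> U, (forall n, X (u n)) /\
    forall n, pdvd p n (x - \sum_(i < n) f (u i) *+ p ^ i).
Proof.
move=> step.
have [x|F FP] := @choice V (U * V)%type
    (fun x y => P x -> [/\ X y.1, P y.2 & x = f y.1 + y.2 *+ p]).
  have [Px|nPx] := pselect (P x); last by exists (0, 0).
  by have [a [x' H]] := step x Px; exists (a, x').
move=> x Px; pose s n := iter n (fun y => (F y).2) x.
have Ps n : P (s n) by elim: n => //= n /FP[].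
exists (fun n => (F (s n)).1); split=> [n|n]; first by have [] := FP _ (Ps n).
suff -> : x = \sum_(i < n) f (F (s i)).1 *+ p ^ i + s n *+ p ^ n.
  by rewrite addrAC subrr add0r; apply: pdvd_exp.
elim: n => [|n IHn]; first by rewrite big_ord0 add0r mulr1n.
rewrite big_ord_recr /= -addrA {1}IHn; congr (_ + _).
have [_ _ {1}->] := FP _ (Ps n).
by rewrite mulrnDl -mulrnA expnS.
Qed.

(** Takes the place of Nakayama's lemma where [P] has no finiteness: the digits of [x] are summed in
    the complete group [U], and separatedness of [V] identifies the result. As [f] is only additive,
    it may be linear over Sigma, linear over S, or p^r times the inclusion. *)
Lemma padic_closed (U V : zmodType) (P : set V) (f : {additive U -> V}) :
  padic_complete p U -> (forall x : V, (forall n, pdvd p n x) -> x = 0) ->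
  (forall x, P x -> exists a x', P x' /\ x = f a + x' *+ p) ->
  forall x, P x -> exists a, x = f a.
Proof.
move=> cU sep step x Px.
have [|u [_ uP]] := @padic_expansion U V P setT f _ x Px.
  by move=> y /step[a [x' []]]; exists a, x'.
have [a aP] := padic_series u cU; exists a.
apply/eqP; rewrite -subr_eq0; apply/eqP/sep => n.
rewrite -[x](subrK (\sum_(i < n) f (u i) *+ p ^ i)) -addrA.
apply: pdvdD => //; rewrite -opprB; apply: pdvdN.
have -> : \sum_(i < n) f (u i) *+ p ^ i = f (\sum_(i < n) u i *+ p ^ i).
  by rewrite raddf_sum; apply: eq_bigr => i _; rewrite raddfMn.
by rewrite -raddfB; apply: pdvd_raddf.
Qed.

End Pdvd.

Lemma expD_inj (p n : nat) (V : zmodType) (x y : V) :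
  (forall z : V, z *+ p = 0 -> z = 0) -> x *+ p ^ n = y *+ p ^ n -> x = y.
Proof.
move=> tf /eqP; rewrite -subr_eq0 -mulrnBl => /eqP xy0; apply/eqP.
rewrite -subr_eq0; apply/eqP; elim: n xy0 => [|n IHn]; first by rewrite mulr1n.
by rewrite expnSr mulrnA => /tf.
Qed.

(** * The p-adic valuation of factorials *)

Section Logn.
Variables (p : nat) (p_prime : prime p).

(** Legendre's formula with its first term split off. *)
Lemma logn_fact_rec n : logn p n`! = (n %/ p + logn p (n %/ p)`!)%N.
Proof.
have p1 := prime_gt1 p_prime.
rewrite !logn_fact//; have [->|n0] := posnP n.
  by rewrite div0n !big_geq.
rewrite big_ltn// expn1; congr (_ + _)%N; rewrite big_add1 /=.
have lt : (n %/ p < n)%N by rewrite ltn_Pdiv.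
rewrite (@big_cat_nat _ _ _ (n %/ p).+1) //= [X in (_ + X)%N]big1_seq ?addn0.
  by apply: eq_bigr => i _; rewrite expnS divnMA.
move=> i /andP[_]; rewrite mem_index_iota => /andP[ni _].
rewrite expnS divnMA divn_small// (leq_trans ni)// ltnW// ltn_expl//.
Qed.

Lemma logn_fact_small n : (n < p)%N -> logn p n`! = 0%N.
Proof. by move=> np; rewrite logn_fact_rec divn_small// fact0 logn1. Qed.

(** With m = n / p the valuation is m + v(m!). If m < p it is m, and m + p - 1 <= m p; otherwise
    induction on m bounds the left side by 2 m <= m p. *)
Lemma logn_fact_leq n : (p <= n)%N -> (logn p n`! + p.-1 <= n)%N.
Proof.
have p1 := prime_gt1 p_prime; have p0 := ltnW p1.
elim/ltn_ind: n => n IHn pn; rewrite logn_fact_rec; set m := (n %/ p)%N.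
have m0 : (0 < m)%N by rewrite divn_gt0.
have mn : (m * p <= n)%N by apply: leq_divM.
case: (ltnP m p) => [/logn_fact_small ->|pm].
  rewrite addn0; apply: leq_trans mn; rewrite -(prednK p0) mulnS leq_add2l.
  by rewrite leq_pmull.
have mltn : (m < n)%N by rewrite ltn_Pdiv// (leq_trans p0).
rewrite -addnA; apply: leq_trans mn; apply: (@leq_trans (m + m)).
  by rewrite leq_add2l; apply: IHn.
by rewrite addnn -muln2 leq_mul.
Qed.

Lemma logn_fact_leqB n r : (r <= p.-1)%N -> (r <= n)%N -> (logn p n`! + r <= n)%N.
Proof.
move=> rp rn; case: (ltnP n p) => [/logn_fact_small ->//|/logn_fact_leq].
by apply: leq_trans; rewrite leq_add2l.
Qed.

End Logn.

(** * The ring S and its filtration *)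

Section BreuilRing.
Variables (p : nat) (p_prime : prime p) (k : fieldType).
Variables (W : idomainType) (res : {rmorphism W -> k}).
Hypothesis W_witt : is_witt_ring p res.
Variables (E : {poly W}) (E_monic : E \is monic) (sE1 : (1 < size E)%N).
Variables (D : comNzRingType) (J : set D) (g : nat -> D -> D).
Variables (inc : {rmorphism {poly W} -> D}).
Variables (S : comNzRingType) (cpl : {rmorphism D -> S}).
Hypothesis S_breuil : is_breuil_ring p E J g inc cpl.

Let env := S_breuil.1.
Local Notation y := (inc E).
Local Notation FS := (FilS p E g inc cpl).

Lemma witt_adic : adic (p%:R : W) W^o.
Proof. by case: W_witt => _ Wc _ _; apply: (@padic_adic p W W^o). Qed.

(** Write n = m p^l: the factor m prime to p is invertible by completeness, and p is nonzero in a
    domain. *)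
Lemma witt_pchar0 n : (0 < n)%N -> n%:R != 0 :> W.
Proof.
move=> n0; have [_ p0 _] := W_witt; case: (pfactor_coprime p_prime n0) => m pm ->.
rewrite natrM natrX mulf_neq0// ?expf_neq0//; last by case: W_witt.
have m0 : (0 < m)%N by case: m pm => //; rewrite /coprime gcdn0; case: p p_prime => [|[]].
have [v vm] := padic_natr_unit m0 pm witt_adic.
by apply: contraTneq (oner_neq0 W) => m00; rewrite -vm m00 mulr0 eqxx.
Qed.

Lemma witt_unit w : res w != 0 -> exists v, v * w = 1.
Proof.
move=> w0; have [_ _ surj ker] := W_witt; have [v vE] := surj (res w)^-1.
have /ker[z zE] : res (1 - v * w) = 0.
  by rewrite rmorphB rmorph1 rmorphM vE mulVf ?subrr.
have [t tE] := adic_unit witt_adic z; exists (t * v).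
rewrite -mulrA -[RHS]tE; congr (_ * _).
by rewrite mulr_natl -[p]expn1 -zE opprB addrC subrK.
Qed.

Let Jy : J y.
Proof. by case: env => _ + _; apply; exists 1; rewrite mul1r. Qed.

Lemma pd_factM n : g n y *+ n`! = y ^+ n.
Proof.
case: env => -[_ /(_ _ Jy)[g0 g1 _] _ _ [gM _]] _ _.
elim: n => [|n IHn]; first by rewrite g0.
have yg : y * g n y = g n.+1 y *+ n.+1 by rewrite -{1}g1 gM// add1n bin1.
by rewrite exprS -IHn mulrnAr yg factS mulrnA.
Qed.

Let D_tf (x : D) : x *+ p = 0 -> x = 0.
Proof.
apply: (pd_envelope_torsion_free witt_pchar0 E_monic sE1 env).
exact: prime_gt0.
Qed.

Lemma S_padic : padic_complete p S.
Proof. by case: S_breuil.2. Qed.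

(** Torsion-freeness passes from [D] to its completion because [cpl] reflects divisibility by powers
    of p. *)
Lemma S_torsion_free (x : S) : x *+ p = 0 -> x = 0.
Proof.
case: S_breuil.2 => -[sep _] cplp dense xp0; apply: sep => n.
(* One power more than the goal asks for: cancelling p in the multiple [d *+ p] costs one. *)
have [d dE] := dense n.+1 x.
rewrite -[x](subrK (cpl d)); apply: pdvdD; first exact: pdvdW dE.
apply/cplp; have [z zE] : pdvd p n.+1 (d *+ p).
  apply/cplp; rewrite rmorphMn -[cpl d](subKr x) mulrnBl xp0 sub0r.
  apply: pdvdN; have [z ->] := dE; exists (z *+ p); by rewrite mulrnAC.
by exists z; apply: (@expD_inj p 1) => //; rewrite expn1 zE expnSr mulrnA.
Qed.

Lemma ideal_gen_pdspan j v :
  ideal_gen [set x | exists2 i, (j <= i)%N & x = g i y]%classic v <->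
  pdspan E g inc j v.
Proof.
split; last first.
  move: v; apply: pdspan_ind => [|x x'|a i ji]; first exact: span_of0.
    exact: span_ofD.
  by apply: (@span_ofZ _ D^o); apply: span_of_gen; exists i.
move: v; apply: (@span_of_ind _ D^o _ (pdspan E g inc j)) => [|x x'|a _ [i ji ->]].
  exact: pdspan0.
  exact: pdspanD.
rewrite -[a *: _]/(a * g i y) mulrC; apply: (pdspanM env); last exact: (pd_envelope_span env).
rewrite -[g i y]mul1r -(rmorph1 inc); exact: pdspan_gen.
Qed.

Lemma FilSP j x : FS j x <-> exists v : nat -> D,
  (forall i, pdspan E g inc j (v i)) /\ forall n, pdvd p n (x - \sum_(i < n) cpl (v i) *+ p ^ i).
Proof.
split=> [[u [uI du xu]]|[v [vj xv]]].
  have [z zP] := choice (fun n => let: ex_intro2 z Iz zE := du n in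
    ex_intro (fun z => ideal_gen _ z /\ u n.+1 - u n = z *+ p ^ n) z (conj Iz zE)).
  (* The partial sum of length n + 1 is to be u_(n+1), so the term of index 0 is u_1 = u_0 + z_0;
     for length 0 there is nothing to check. *)
  exists (fun n => if n is m.+1 then z n else u 0%N + z 0%N).
  split=> [n|n].
    apply/ideal_gen_pdspan; case: n => [|n]; last by have [] := zP n.+1.
    by apply: (@span_ofD _ D^o); [apply: uI|have [] := zP 0%N].
  case: n => [|n]; first by exists x; rewrite big_ord0 subr0.
  suff -> : \sum_(i < n.+1) cpl (if val i is m.+1 then z i else u 0%N + z 0%N)
    *+ p ^ i = cpl (u n.+1) by [].
  elim: n => [|n IHn].
    have [_] := zP 0%N; rewrite mulr1n big_ord1 mulr1n => <-.
    by rewrite addrC subrK.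
  rewrite big_ord_recr /= IHn; have [_] := zP n.+1.
  by rewrite -rmorphMn => <-; rewrite -rmorphD addrC subrK.
exists (fun n => \sum_(i < n) v i *+ p ^ i); split=> [n|n|n].
- apply: (@span_of_sum _ D^o) => i; rewrite -mulr_natl.
  exact/(@span_ofZ _ D^o)/ideal_gen_pdspan.
- exists (v n); first exact/ideal_gen_pdspan.
  by rewrite big_ord_recr /= addrAC subrr add0r.
- have -> // : cpl (\sum_(i < n) v i *+ p ^ i) = \sum_(i < n) cpl (v i) *+ p ^ i.
  by rewrite rmorph_sum; apply: eq_bigr => i _; rewrite rmorphMn.
Qed.

Lemma FilS_cpl j v : pdspan E g inc j v -> FS j (cpl v).
Proof.
move=> vj; apply/FilSP; exists (fun n => if n is 0 then v else 0).
split=> [[|n]|[|n]]; rewrite ?big_ord0 ?subr0; do ?[exact: pdspan0|by exists (cpl v)].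
  by [].
rewrite big_ord_recl big1 ?addr0 ?subrr; first exact: pdvd0.
by move=> i _; rewrite rmorph0 mul0rn.
Qed.

Lemma FilS_step j x : FS j x ->
  exists v x', [/\ pdspan E g inc j v, FS j x' & x = cpl v + x' *+ p].
Proof.
move=> /FilSP[v [vj xv]]; have [z] := xv 1%N.
rewrite big_ord1 mulr1n expn1 => zE.
exists (v 0%N), z; split=> //; last by rewrite -zE addrC subrK.
apply/FilSP; exists (fun n => v n.+1); split=> // n.
have [t tE] := xv n.+1; exists t; apply: (@expD_inj p 1) S_torsion_free _.
rewrite expn1 mulrnBl -zE -mulrnA -expnSr -tE big_ord_recl mulr1n opprD addrA.
congr (_ - _); rewrite -sumrMnl; apply: eq_bigr => i _.
by rewrite -mulrnA -expnSr.
Qed.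

(** Membership by coinduction: unfolding the hypothesis again and again yields the digits required
    by [FilSP], without handling Cauchy sequences. *)
Lemma FilS_coind j (P : set S) :
  (forall x, P x -> exists v x',
     [/\ pdspan E g inc j v, P x' & x = cpl v + x' *+ p]) ->
  forall x, P x -> FS j x.
Proof. by move=> step x /(padic_expansion step)[v vP]; apply/FilSP; exists v. Qed.

Lemma FilSW i j x : (i <= j)%N -> FS j x -> FS i x.
Proof.
move=> ij /FilSP[v [vj xv]]; apply/FilSP; exists v; split=> // n.
have [s sj ->] := vj n; exists s => //; apply: sub_all sj => t.
exact: leq_trans.
Qed.

Lemma cpl_dense x : exists d x', x = cpl d + x' *+ p.
Proof.
have [d [x' xE]] := (let: And3 _ _ dense := S_breuil.2 in dense) 1%N x.
by exists d, x'; rewrite -[p in RHS]expn1 -xE addrC subrK.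
Qed.

Lemma FilS_submod j : @submodule S S^o (FS j).
Proof.
(* Coinduction runs on the S-span of Fil^j S, because expanding a x leaves the remainder a' v + a
   x', visibly a combination of elements of Fil^j S but not yet an element. *)
suff span x : @span_of S S^o (FS j) x -> FS j x.
  split=> [|a x x' Fx Fx']; apply: span; first exact: span_of0.
  by apply: span_ofD; [apply/span_ofZ/span_of_gen|apply: span_of_gen].
move: x; apply: FilS_coind; apply: (@span_of_ind _ S^o) => [|x x'|a x Fx].
- exists 0, 0; split; [exact: pdspan0|exact: span_of0|].
  by rewrite rmorph0 mul0rn addr0.
- move=> [v [z [vj Pz ->]]] [v' [z' [v'j Pz' ->]]].
  exists (v + v'), (z + z'); split; [exact: pdspanD|exact: span_ofD|].
  by rewrite rmorphD mulrnDl addrACA.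
have [v [x' [vj Fx' xE]]] := FilS_step Fx.
have [d [a' aE]] := cpl_dense a.
exists (v * d), (a' * cpl v + a * x'); split.
- exact/(pdspanM env)/(pd_envelope_span env).
- apply: (@span_ofD _ S^o); last exact/(@span_ofZ _ S^o)/span_of_gen.
  exact/(@span_ofZ _ S^o)/span_of_gen/FilS_cpl.
rewrite -[a *: _]/(a * x) {1}xE mulrDr {1}aE mulrDl rmorphM [cpl v * _]mulrC.
by rewrite mulrnDl addrA mulrnAl mulrnAr.
Qed.

Lemma FilS_E r : FS r (cpl y ^+ r).
Proof.
rewrite -rmorphXn; apply: FilS_cpl; rewrite -pd_factM -mulr_natl.
by rewrite -(rmorph_nat inc); apply: pdspan_gen.
Qed.

(* For [i < p] the factorial [i!] is invertible modulo [p]. *)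
Lemma S_mod_FilS x : exists (a : {poly W}) v x',
  x = cpl (inc a) + cpl v + x' *+ p /\ pdspan E g inc p v.
Proof.
have [d [x' ->]] := cpl_dense x.
suff [a [v [z [-> vp]]]] : exists a v z, d = inc a + v + z *+ p /\
    pdspan E g inc p v.
  exists a, v, (cpl z + x'); split=> //.
  by rewrite !rmorphD rmorphMn mulrnDl !addrA.
move: d (pd_envelope_span env d); apply: pdspan_ind => [|d d'|a i _].
- by exists 0, 0, 0; rewrite rmorph0 mul0rn !addr0; split=> //; apply: pdspan0.
- move=> [a [v [z [-> vp]]]] [a' [v' [z' [-> v'p]]]].
  exists (a + a'), (v + v'), (z + z'); split; last exact: pdspanD.
  by rewrite rmorphD mulrnDl !addrA; ring.
have [pi|ip] := leqP p i.
  exists 0, (inc a * g i y), 0; rewrite rmorph0 mul0rn addr0 add0r.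
  by split=> //; apply: pdspan_gen.
have [m pm im] := pfactor_coprime p_prime (fact_gt0 i).
rewrite logn_fact_small// muln1 in im; rewrite -{}im in pm.
have [u w uw _] := egcdnP p (fact_gt0 i); rewrite gcdnC (eqP pm) in uw.
exists (a * E ^+ i *+ u), 0, (- (inc a * g i y *+ w)); split; last exact: pdspan0.
rewrite addr0 rmorphMn rmorphM rmorphXn -pd_factM mulrnAr -mulrnA mulnC uw.
by rewrite mulrnDr mulr1n mulNrn -mulrnA addrAC subrr add0r.
Qed.

(** * Frobenius on Sigma and on S *)

Section Frobenius.
Variables (sigma : {rmorphism W -> W}) (phiS : {rmorphism S -> S}).
Hypothesis phiS_frob : is_frobenius_S p (cpl \o inc) sigma phiS.
Variable iota : {rmorphism Sigma p E -> S}.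
Hypothesis iota_incl : is_Sigma_inclusion (cpl \o inc) iota.
Variable phiSig : {rmorphism Sigma p E -> Sigma p E}.
Hypothesis phiSig_frob : forall x, iota (phiSig x) = phiS (iota x).

Definition tau : {rmorphism {poly W} -> Sigma p E} :=
  in_qpoly (sigma_modulus p E) \o map_poly (@fpsC W).

Definition phi_poly : {rmorphism {poly W} -> {poly W}} :=
  comp_poly ('X^p : {poly W}) \o map_poly sigma.

Lemma iota_tau a : iota (tau a) = cpl (inc a).
Proof.
case: iota_incl => _ iotaC iotaX _.
elim/poly_ind: a => [|a c IHa]; first by rewrite !rmorph0.
have tC : iota (tau c%:P) = cpl (inc c%:P).
  by rewrite -[RHS]iotaC; congr (iota _); rewrite /= map_polyC.
have tX : iota (tau 'X) = cpl (inc 'X).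
  by rewrite -[RHS]iotaX; congr (iota _); rewrite /= map_polyX.
by rewrite !(rmorphD, rmorphM) IHa tC tX.
Qed.

Lemma iota_inj : injective iota. Proof. by case: iota_incl. Qed.

Lemma phiSig_tau a : phiSig (tau a) = tau (phi_poly a).
Proof.
case: phiS_frob => frobC frobX; apply: iota_inj; rewrite phiSig_frob !iota_tau.
elim/poly_ind: a => [|a c IHa]; first by rewrite !rmorph0.
have tC : phiS (cpl (inc c%:P)) = cpl (inc (phi_poly c%:P)).
  by rewrite [LHS]frobC /= map_polyC comp_polyC.
have tX : phiS (cpl (inc 'X)) = cpl (inc (phi_poly 'X)).
  by rewrite [LHS]frobX /= map_polyX comp_polyX !rmorphXn.
by rewrite !(rmorphD, rmorphM) IHa tC tX.
Qed.

Local Notation Y := (toSigma p E fpsY%:P).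

Lemma Sigma_torsion_free (x : Sigma p E) : x *+ p = 0 -> x = 0.
Proof.
move=> xp0; apply: iota_inj; rewrite rmorph0; apply: S_torsion_free.
by rewrite -rmorphMn xp0 rmorph0.
Qed.

Lemma Sigma_padic : padic_complete p (Sigma p E).
Proof. exact/(@adic_padic p _ (Sigma p E)^o)/Sigma_adic_p/witt_adic. Qed.

(** [{poly %/ h}] is the quotient by [h] only for [h] monic of size above 1, since [mk_monic]
    replaces other moduli; the relation E^p = p Y depends on this. *)
Lemma sigma_modulus_monic : sigma_modulus p E \is monic /\ (1 < size (sigma_modulus p E))%N.
Proof.
pose Ef := map_poly (@fpsC W) E.
have Ef_monic : Ef \is monic by rewrite monic_map.
have sEf : size Ef = size E by rewrite size_map_poly_id0// (monicP E_monic) rmorph1 oner_neq0.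
have s1 : (1 < size (Ef ^+ p))%N.
  case: (p) (prime_gt0 p_prime) => // n _; rewrite exprS size_Mmonic ?monic_exp//.
    have := monic_neq0 (monic_exp n Ef_monic); rewrite -size_poly_gt0.
    by case: (size (Ef ^+ n)) => // m _; rewrite addnS /= sEf (leq_trans sE1)// leq_addr.
  by rewrite monic_neq0.
have sY : (size (- ((p%:R * fpsY)%:P : {poly fps W})) < size (Ef ^+ p))%N.
  by rewrite size_polyN (leq_ltn_trans (size_polyC_leq1 _)).
split; last by rewrite /sigma_modulus size_polyDl.
by rewrite monicE /sigma_modulus lead_coefDl// (monicP (monic_exp p Ef_monic)).
Qed.

Lemma tau_E_exp : tau E ^+ p = Y *+ p.
Proof.
have [hm hs] := sigma_modulus_monic.
have hE : mk_monic (sigma_modulus p E) = sigma_modulus p E.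
  by rewrite /mk_monic hm hs.
rewrite -mulr_natl; apply/eqP; rewrite -subr_eq0; apply/eqP.
have -> : tau E ^+ p - p%:R * Y = in_qpoly (sigma_modulus p E) (sigma_modulus p E).
  have gen h (A : {poly fps W}) : in_qpoly h (A ^+ p - (p%:R * fpsY)%:P) =
      in_qpoly h A ^+ p - p%:R * in_qpoly h fpsY%:P.
    by rewrite rmorphB rmorphXn polyCM rmorphM polyC_natr rmorph_nat.
  exact: esym (gen _ _).
apply: val_inj; rewrite /= hE.
by rewrite Pdiv.RingMonic.rmodpp.
Qed.

Hypothesis E_eis : eisenstein p E.

(** The constant term of F is a unit because p^2 does not divide E(0) = p F(0). *)
Lemma eisenstein_decomp : exists F : {poly W},
  E = 'X ^+ (size E).-1 + F *+ p /\ exists v, v * F.[0] = 1.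
Proof.
case: E_eis => _ _ Ep E0.
have [i|f fE] := @choice nat W (fun i c => (i < (size E).-1)%N -> E`_i = c *+ p).
  have [/Ep[c cE]|ni] := ltnP i (size E).-1; last by exists 0.
  by exists c; rewrite -[p in RHS]expn1.
have e0 : (0 < (size E).-1)%N by rewrite -subn1 subn_gt0.
exists (\poly_(i < (size E).-1) f i); split.
  apply/polyP => i; rewrite coefD coefMn coef_poly coefXn.
  have [ie|ei|->] := ltngtP i (size E).-1; rewrite ?mul0rn ?add0r ?addr0.
  - exact: fE.
  - by rewrite nth_default// -(prednK (ltnW sE1)).
  - by rewrite -lead_coefE (monicP E_monic).
rewrite horner_coef0 coef_poly e0; apply: witt_unit; apply/eqP.
have [_ _ _ ker] := W_witt.
move=> /ker[z zE]; apply: E0; exists z.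
by rewrite fE// zE -mulrnA expn1.
Qed.

(* [phi (E) / p] is [Y] plus a polynomial whose constant coefficient is a unit. *)
Lemma Sigma_c : exists c d : Sigma p E, phiSig (tau E) = c *+ p /\ d * c = 1.
Proof.
have [F [EF [v vF]]] := eisenstein_decomp.
have p0 := prime_gt0 p_prime; have p1 := prime_gt1 p_prime.
set e := (size E).-1 in EF.
have e0 : (0 < e)%N by rewrite /e -subn1 subn_gt0.
(* E^p - u^(ep) = (E - u^e) Q = p F Q; together with E^p = p Y this gives u^(ep) = p (Y - F Q) in
   Sigma. *)
pose Q := \sum_(i < p) E ^+ (p.-1 - i) * ('X^e) ^+ i.
have XeE : 'X^e ^+ p = E ^+ p - F * Q *+ p :> {poly W}.
  have := subrXX E 'X^e p; rewrite {2}EF addrAC subrr add0r -/Q => H.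
  by rewrite -mulrnAl -H opprB addrC subrK.
have tXe : tau ('X^e ^+ p) = (Y - tau (F * Q)) *+ p.
  by rewrite XeE rmorphB rmorphXn rmorphMn tau_E_exp mulrnBl.
(* phi(E) = u^(ep) + p phi(F), hence phi(E) / p = C + Y. *)
pose C := phi_poly F - F * Q.
have phiE : phiSig (tau E) = (tau C + Y) *+ p.
  have -> : phiSig (tau E) = tau ('X^e ^+ p) + tau (phi_poly F) *+ p.
    rewrite phiSig_tau -rmorphMn -rmorphD; congr (tau _).
    rewrite {1}EF rmorphD rmorphMn rmorphXn /= map_polyX comp_polyX.
    by rewrite -!exprM [(p * e)%N]mulnC.
  rewrite tXe -mulrnDl; congr (_ *+ _).
  by rewrite rmorphB addrAC [Y + _]addrC addrAC.
exists (tau C + Y).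
have C0 : C.[0] = sigma F.[0] - F.[0] * E.[0] ^+ p.-1.
  have F0 : (phi_poly F).[0] = sigma F.[0].
    rewrite /= horner_comp hornerXn expr0n eqn0Ngt p0 /=.
    by rewrite -[X in _.[X]](rmorph0 sigma) horner_map.
  rewrite hornerD hornerN F0 hornerM; congr (_ - _ * _).
  rewrite horner_sum (bigD1 (Ordinal p0)) //= big1 ?addr0 ?subn0.
    by rewrite expr0 mulr1 horner_exp.
  move=> i i0; rewrite hornerM !horner_exp hornerX.
  have : val i != 0%N by apply: contraNneq i0 => i0; apply/eqP/val_inj.
  by rewrite expr0n (gtn_eqF e0) expr0n => /negPf ->; rewrite mulr0.
(* sigma(F(0)) has inverse [sigma v], and the correction term contains E(0)^(p-1), divisible by p
   because p >= 2. *)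
have [w wC] : exists w, w * C.[0] = 1.
  have E0 : E.[0] = F.[0] *+ p.
    by rewrite {1}EF hornerD hornerXn expr0n (gtn_eqF e0) add0r hornerMn.
  have [t tE] := adic_unit witt_adic (sigma v * F.[0] ^+ p * p%:R ^+ p.-2).
  exists (t * sigma v); rewrite -[RHS]tE -[LHS]mulrA; congr (_ * _).
  rewrite C0 mulrBr -rmorphM vF rmorph1; congr (_ - _).
  rewrite E0 -mulr_natr exprMn.
  have -> : p.-1 = p.-2.+1 by rewrite prednK// -subn1 subn_gt0.
  have -> : F.[0] ^+ p = F.[0] * F.[0] ^+ p.-2.+1.
    by rewrite -exprS !prednK// -subn1 subn_gt0.
  rewrite [p%:R ^+ p.-2.+1]exprS; ring.
have [G GE] : exists G, C - C.[0]%:P = G * 'X.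
  have /factor_theorem[G ->] : root (C - C.[0]%:P) 0.
    by rewrite /root hornerD hornerN hornerC subrr.
  by exists G; rewrite subr0.
(* u is nilpotent modulo p, since u^(ep) is a multiple of p; a polynomial with unit constant term is
   therefore a unit of Sigma. *)
have [y0 y0E] : exists y0, y0 * tau C = 1.
  have [z zE] : exists z, z * (1 - tau (- (w%:P * G * 'X))) = 1.
    apply: (@adic_unit_nil _ p%:R _ (e * p) (Sigma_adic_p E witt_adic)).
    exists (tau ((- (w%:P * G)) ^+ (e * p)) * (Y - tau (F * Q))).
    rewrite mulr_natl -mulrnAr -tXe -exprM -rmorphM -exprMn -rmorphXn.
    by rewrite mulNr.
  exists (z * tau w%:P); rewrite -[RHS]zE -[LHS]mulrA; congr (_ * _).
  rewrite -rmorphM -(rmorph1 tau) -rmorphB; congr (tau _).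
  have wC' : w%:P * C.[0]%:P = 1 by rewrite -polyCM wC.
  by rewrite opprK -mulrA -GE [in RHS]mulrBr wC' addrC subrK.
(* Completeness for Y absorbs the last summand: y0 (C + Y) = 1 + y0 Y. *)
have [z zE] := adic_unit (Sigma_adic_Y p E) (- y0).
exists (z * y0); split=> //.
by rewrite -[RHS]zE -[LHS]mulrA; congr (_ * _); rewrite mulrDr y0E mulrN opprK mulrC.
Qed.

(** phi(g_n(E)) is c^n p^n / n!. The part of n! prime to p is a unit, its p-part p^l is cancelled by
    torsion-freeness, and l + r <= n leaves a factor p^r. *)
Lemma phi_divided_power r n : (r <= p.-1)%N -> (r <= n)%N ->
  exists t, phiS (cpl (g n y)) = iota t *+ p ^ r.
Proof.
move=> rp rn; have [c [_ [cE _]]] := Sigma_c.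
have phiE : phiS (cpl y) = iota c *+ p.
  by rewrite -iota_tau -phiSig_frob cE rmorphMn.
have [m pm im] := pfactor_coprime p_prime (fact_gt0 n).
set l := logn p n`! in im; have lrn : (l + r <= n)%N by apply: logn_fact_leqB.
have m0 : (0 < m)%N by move: (fact_gt0 n); rewrite im; case: (m).
have [u um] := padic_natr_unit m0 pm (Sigma_adic_p E witt_adic).
have : phiS (cpl (g n y)) *+ m = iota (c ^+ n) *+ p ^ (n - l).
  apply: (@expD_inj p l) S_torsion_free _.
  rewrite -mulrnA -im -!rmorphMn pd_factM !rmorphXn phiE -[in RHS]mulrnA -expnD.
  rewrite subnK; last exact: leq_trans (leq_addr _ _) lrn.
  by rewrite exprMn_n rmorphMn rmorphXn.
have -> : (n - l = n - l - r + r)%N.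
  by rewrite subnK// leq_subRL// (leq_trans _ lrn)// leq_addr.
rewrite expnD mulrnA => H; exists (u * (c ^+ n *+ p ^ (n - l - r))).
rewrite rmorphM rmorphMn -mulrnAr -H -[LHS]mul1r -(rmorph1 iota) -um rmorphM.
by rewrite rmorph_nat -mulrA mulr_natl.
Qed.

Lemma phi_pdspan r v : (r <= p.-1)%N -> pdspan E g inc r v ->
  exists t, phiS (cpl v) = iota t *+ p ^ r.
Proof.
move=> rp; move: v; apply: pdspan_ind => [|v w [t tE] [s sE]|a i ri].
- by exists 0; rewrite !rmorph0 mul0rn.
- by exists (t + s); rewrite !rmorphD tE sE mulrnDl.
have [t tE] := phi_divided_power rp ri; exists (tau (phi_poly a) * t).
by rewrite !rmorphM tE -iota_tau -phiSig_frob phiSig_tau mulrnAr.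
Qed.

Let S_sep (x : S) : (forall n, pdvd p n x) -> x = 0.
Proof. by case: S_padic => sep _ /sep. Qed.

Lemma phi_FilS r x : (r <= p.-1)%N -> FS r x ->
  exists t, phiS x = iota t *+ p ^ r.
Proof.
move=> rp Fx.
(* With p^r times the inclusion as [f], divisibility and descent to Sigma are obtained by one
   approximation. *)
pose f : {additive Sigma p E -> S} := (GRing.mull_fun (p ^ r)%:R iota).
suff [t ->] : exists t, phiS x = f t by exists t; rewrite /f /= mulr_natl.
apply: (@padic_closed p _ _ (fun z => exists2 x, FS r x & z = phiS x)%classic
  f Sigma_padic S_sep); last by exists x.
move=> _ [{}x {}Fx ->]; have [v [x' [vr Fx' ->]]] := FilS_step Fx.
have [t tE] := phi_pdspan rp vr.
exists t, (phiS x'); split; first by exists x'.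
by rewrite rmorphD rmorphMn tE /f /= mulr_natl.
Qed.

Lemma FilS0 x : FS 0 x.
Proof.
apply: (@FilS_coind 0 setT) => // {}x _; have [d [x' xE]] := cpl_dense x.
by exists d, x'; split=> //; apply: (pd_envelope_span env).
Qed.

Lemma phi_S x : exists t, phiS x = iota t.
Proof. by have [t ->] := phi_FilS (leq0n _) (FilS0 x); exists t. Qed.

(** Expand x as the sum of p^n (a_n + v_n): the polynomials a_n sum up in the complete ring Sigma,
    the v_n in Fil^p S. *)
Lemma S_Sigma_FilS x : exists a v, x = iota a + v /\ FS p v.
Proof.
have [z _|u [uP xu]] := @padic_expansion p ({poly W} * D)%type S setT
  (fun t => pdspan E g inc p t.2)%classic (fun t => cpl (inc t.1) + cpl t.2) _ x I.
  have [a [v [x' [-> vp]]]] := S_mod_FilS z.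
  by exists (a, v), x'.
have [a aP] := padic_series (fun n => tau (u n).1) Sigma_padic.
exists a, (x - iota a); split; first by rewrite addrC subrK.
apply/FilSP; exists (fun n => (u n).2); split=> // n.
have -> : x - iota a - \sum_(i < n) cpl (u i).2 *+ p ^ i =
    (x - \sum_(i < n) (cpl (inc (u i).1) + cpl (u i).2) *+ p ^ i) -
    iota (a - \sum_(i < n) tau (u i).1 *+ p ^ i).
  rewrite rmorphB rmorph_sum.
  have -> : \sum_(i < n) (cpl (inc (u i).1) + cpl (u i).2) *+ p ^ i =
     \sum_(i < n) iota (tau (u i).1 *+ p ^ i) + \sum_(i < n) cpl (u i).2 *+ p ^ i.
    rewrite -big_split; apply: eq_bigr => i _ /=.
    by rewrite mulrnDl rmorphMn iota_tau.
  by ring.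
apply: pdvdD => //; apply: pdvdN; exact: (@pdvd_raddf _ _ _ _ iota).
Qed.

End Frobenius.
End BreuilRing.

(** * Filtered modules over a ring with Frobenius *)

Lemma exquoE (A : comNzRingType) (x y z : A) :
  z * y = x -> (forall a b : A, a * y = b * y -> a = b) -> exquo x y = z.
Proof. by move=> zE yreg; apply: xget_unique => // t /= tE; apply: yreg; rewrite tE. Qed.

(** What the module theory asks of its ring; it holds for Sigma and for S, so the same lemmas serve
    both. [c] is a parameter because [c_of] is meaningful only once the quotient is known to
    exist. *)
Record good_ring (p r : nat) (A : filFrobRing) (c : A) : Prop := GoodRing {
  gr_torsion_free : forall x : A, x *+ p = 0 -> x = 0;
  gr_c : ffrob A (fE A) = c *+ p;
  gr_c_unit : exists d, d * c = 1;
  gr_fil : @submodule A A^o (ffil r);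
  gr_fE : ffil r (fE A ^+ r);
  gr_phi : forall s : A, ffil r s -> exists t, ffrob A s = t *+ p ^ r
}.

Section GoodRing.
Variables (p r : nat) (A : filFrobRing) (c : A).
Hypothesis gA : good_ring p r c.

Lemma gr_expI (x y : A) n : x *+ p ^ n = y *+ p ^ n -> x = y.
Proof. exact/expD_inj/gr_torsion_free/gA. Qed.

Lemma c_ofE : c_of p A = c.
Proof.
apply: exquoE; first by rewrite (gr_c gA) mulr_natr.
by move=> a b; rewrite !mulr_natr -[p in LHS]expn1 -[p in RHS]expn1 => /gr_expI.
Qed.

Lemma c_inv : exquo 1 (c_of p A ^+ r) * c ^+ r = 1.
Proof.
have [d dc] := gr_c_unit gA; rewrite c_ofE.
have dcr : d ^+ r * c ^+ r = 1 by rewrite -exprMn dc expr1n.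
rewrite (@exquoE _ _ _ (d ^+ r))// => a b ab.
by rewrite -[a]mulr1 -[b]mulr1 -dcr mulrCA ab mulrCA.
Qed.

Lemma phir_ringE (s : A) : ffil r s -> phir_ring p r s *+ p ^ r = ffrob A s.
Proof.
move=> /(gr_phi gA)[t tE]; rewrite /phir_ring (@exquoE _ _ _ t) ?tE ?mulr_natr//.
by move=> a b; rewrite !mulr_natr => /gr_expI.
Qed.

Lemma vect_torsion_free (V : vectType A) (x : V) : x *+ p = 0 -> x = 0.
Proof.
move=> xp0; apply: (@v2r_inj _ V); rewrite linear0; apply/rowP => i; rewrite mxE.
apply: (gr_torsion_free gA); transitivity ((v2r (x *+ p)) 0 i).
  by rewrite linearMn mulmxnE.
by rewrite xp0 linear0 mxE.
Qed.

Lemma vect_expI (V : vectType A) (x y : V) n : x *+ p ^ n = y *+ p ^ n -> x = y.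
Proof. exact/expD_inj/vect_torsion_free. Qed.

Lemma fil0 (M : filMod p r A) : fil (0 : M).
Proof. by case: (fil_submod M). Qed.

Lemma filD (M : filMod p r A) (x y : M) : fil x -> fil y -> fil (x + y).
Proof. by case: (fil_submod M) => _ /(_ 1 x y); rewrite scale1r. Qed.

Lemma filZ (M : filMod p r A) (a : A) (x : M) : fil x -> fil (a *: x).
Proof. by move=> fx; case: (fil_submod M) => f0 /(_ a x 0 fx f0); rewrite addr0. Qed.

Lemma filB (M : filMod p r A) (x y : M) : fil x -> fil y -> fil (x - y).
Proof. by move=> fx fy; rewrite -scaleN1r; apply/filD/filZ. Qed.

Lemma fil_sum (M : filMod p r A) (I : Type) (s : seq I) (F : I -> M) :
  (forall i, fil (F i)) -> fil (\sum_(i <- s) F i).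
Proof. by move=> fF; elim/big_rec: _ => [|i x _]; [apply: fil0|apply: filD]. Qed.

(** A total version of phi_r, with default 0 off Fil^r, which frees equations from membership
    proofs. *)
Definition phr (M : filMod p r A) (x : M) : M :=
  if pselect (fil x) is left fx then phir (exist _ x fx) else 0.

Lemma phrE (M : filMod p r A) (x : {x : M | fil x}) : phir x = phr (sval x).
Proof.
case: x => x fx; rewrite /phr /=; case: pselect => // fx'.
by congr (phir (exist _ _ _)); apply: Prop_irrelevance.
Qed.

Lemma phr_semilin (M : filMod p r A) (a : A) (x y : M) : fil x -> fil y ->
  phr (a *: x + y) = ffrob A a *: phr x + phr y.
Proof.
move=> fx fy; have fz : fil (a *: x + y) by apply/filD/fy/filZ.
have := @phir_semilin _ _ _ M a (exist _ x fx) (exist _ y fy) (exist _ _ fz) erefl.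
by rewrite !phrE.
Qed.

Lemma phr0 (M : filMod p r A) : phr (0 : M) = 0.
Proof.
have := phr_semilin 1 (fil0 M) (fil0 M); rewrite scaler0 addr0 rmorph1 scale1r.
by move=> /eqP; rewrite -subr_eq0 opprD addNKr oppr_eq0 => /eqP.
Qed.

Lemma phrD (M : filMod p r A) (x y : M) : fil x -> fil y -> phr (x + y) = phr x + phr y.
Proof. by move=> fx fy; rewrite -[x]scale1r phr_semilin// rmorph1 !scale1r. Qed.

Lemma phrZ (M : filMod p r A) (a : A) (x : M) : fil x -> phr (a *: x) = ffrob A a *: phr x.
Proof.
by move=> fx; rewrite -[a *: x]addr0 phr_semilin ?phr0 ?addr0//; apply: fil0.
Qed.

Lemma phrMn (M : filMod p r A) (x : M) n : fil x -> phr (x *+ n) = phr x *+ n.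
Proof. by move=> fx; rewrite -!scaler_nat phrZ// rmorph_nat. Qed.

Lemma phr_gen (M : filMod p r A) (m : M) :
  span_of [set n | exists2 x, fil x & n = phr x]%classic m.
Proof.
have := phir_gen m; apply: span_of_ind; [exact: span_of0|exact: span_ofD|].
move=> a _ [x ->]; apply/span_ofZ/span_of_gen; exists (sval x); first exact: svalP.
by rewrite phrE.
Qed.

Definition phiM (M : filMod p r A) (x : M) : M :=
  exquo 1 (c_of p A ^+ r) *: phr (fE A ^+ r *: x).

Lemma fil_fE (M : filMod p r A) (x : M) : fil (fE A ^+ r *: x).
Proof. exact/fil_sub/gr_fE/gA. Qed.

Lemma phiM_semilin (M : filMod p r A) (a : A) (x y : M) :
  phiM (a *: x + y) = ffrob A a *: phiM x + phiM y.
Proof.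
rewrite /phiM scalerDr scalerA mulrC -scalerA phr_semilin; try exact: fil_fE.
by rewrite scalerDr !scalerA mulrC.
Qed.

Lemma phiM_sum (M : filMod p r A) n (a : 'I_n -> A) (x : 'I_n -> M) :
  phiM (\sum_i a i *: x i) = \sum_i ffrob A (a i) *: phiM (x i).
Proof.
have phiM0 : phiM (0 : M) = 0 by rewrite /phiM scaler0 phr0 scaler0.
by elim/big_rec2: _ => // i y z _ <-; rewrite phiM_semilin.
Qed.

(** By semilinearity phi_r(E^r x) = phi(E)^r phi_r(x) = c^r p^r phi_r(x). *)
Lemma phr_phiM (M : filMod p r A) (x : M) : fil x -> phr x *+ p ^ r = phiM x.
Proof.
move=> fx; rewrite /phiM phrZ// scalerA rmorphXn (gr_c gA) exprMn_n mulrnAr c_inv.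
by rewrite -scaler_nat.
Qed.

Lemma phiM_phr (M : filMod p r A) (x : M) :
  phr (fE A ^+ r *: x) = c ^+ r *: phiM x.
Proof. by rewrite /phiM scalerA mulrC c_inv scale1r. Qed.

End GoodRing.

(** * Objects built from a semilinear phi that is divisible by p^r on the filtration *)

Section Builder.
Variables (p r : nat) (A : filFrobRing) (c : A).
Hypothesis gA : good_ring p r c.
Variables (V : vectType A) (F : set V) (f : V -> V).
Hypotheses (F_sub : submodule F) (FA : forall (s : A) x, ffil r s -> F (s *: x)).
Hypothesis f_semi : forall (a : A) x y, f (a *: x + y) = ffrob A a *: f x + f y.
Hypothesis f_div : forall x, F x -> exists z, f x = z *+ p ^ r.
Hypothesis f_gen : forall m,
  span_of [set z | exists2 x, F x & z *+ p ^ r = f x]%classic m.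
Hypothesis F_tors : forall x, F (x *+ p) -> F x.

(** The quotient of [f] by p^r is unique since free modules have no p-torsion; the identities
    required of phi_r are checked after multiplication by p^r. *)
Let ph (x : {x : V | F x}) : V := xget 0 [set z | z *+ p ^ r = f (sval x)]%classic.

Let phE x : ph x *+ p ^ r = f (sval x).
Proof.
have [z zE] := f_div (svalP x).
by apply: (@xgetPex _ 0 [set z | z *+ p ^ r = f (sval x)]%classic); exists z; rewrite zE.
Qed.

Let phU x z : z *+ p ^ r = f (sval x) -> z = ph x.
Proof. by rewrite -phE => /(vect_expI gA). Qed.

Let f0 : f 0 = 0.
Proof.
have := f_semi 1 0 0; rewrite scaler0 addr0 rmorph1 scale1r.
by move=> /eqP; rewrite -subr_eq0 opprD addNKr oppr_eq0 => /eqP.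
Qed.

Let fZ (a : A) x : f (a *: x) = ffrob A a *: f x.
Proof. by rewrite -[a *: x]addr0 f_semi f0 addr0. Qed.

Fact mk_semilin (a : A) (x y z : {x : V | F x}) :
  sval z = a *: sval x + sval y -> ph z = ffrob A a *: ph x + ph y.
Proof.
move=> zE; apply/esym/phU; rewrite zE f_semi -!phE mulrnDl.
by rewrite -scalerMnr.
Qed.

Fact mk_fil (s : A) x (y z : {x : V | F x}) :
  ffil r s -> sval y = s *: x -> sval z = fE A ^+ r *: x ->
  ph y = exquo 1 (c_of p A ^+ r) *: (phir_ring p r s *: ph z).
Proof.
move=> rs yE zE; apply/esym/phU; rewrite yE.
have -> : ph z = c ^+ r *: f x.
  apply/esym/phU; rewrite zE fZ rmorphXn (gr_c gA) exprMn_n scalerMnl.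
  by rewrite -scalerMnl.
rewrite !scalerA mulrAC (c_inv gA) mul1r fZ -(phir_ringE gA rs).
by rewrite scalerMnl.
Qed.

Fact mk_gen m : span_of [set n | exists x, n = ph x]%classic m.
Proof.
have := f_gen m; apply: span_of_ind; [exact: span_of0|exact: span_ofD|].
move=> a z [x Fx zE]; apply/span_ofZ/span_of_gen; exists (exist _ x Fx).
exact: phU.
Qed.

Definition mk_filMod : filMod p r A :=
  FilMod F_sub FA mk_semilin mk_fil mk_gen F_tors.

Lemma mk_phr (x : V) : F x -> (phr (x : mk_filMod) : V) *+ p ^ r = f x.
Proof. by move=> Fx; rewrite -(phrE (exist _ x Fx : {x : mk_filMod | fil x})) phE. Qed.

End Builder.

(** * Base change of free modules in coordinates *)

Section FreeBaseChange.
Variables (A B : comNzRingType) (iota : {rmorphism A -> B}).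

Definition vbase (M : vectType A) (i : 'I_(dim M)) : M := r2v (delta_mx 0 i).

Lemma vbaseE (M : vectType A) (m : M) : m = \sum_i v2r m 0 i *: vbase i.
Proof.
apply: v2r_inj; rewrite [LHS]row_sum_delta linear_sum; apply: eq_bigr => i _.
by rewrite linearZ /= r2vK.
Qed.

(** The universal property quantifies over all target modules; for free [M] it amounts to the images
    of a basis being a basis, with [co] as coordinate map. *)
Definition free_bc (M : vectType A) (N : lmodType B) (j : M -> N)
    (co : {linear N -> 'rV[B]_(dim M)}) : Prop :=
  [/\ semilinear_along iota j,
      forall m, co (j m) = map_mx iota (v2r m)
    & forall n, n = \sum_i co n 0 i *: j (vbase i)].

Section Theory.
Variables (M : vectType A) (N : lmodType B) (j : M -> N).
Variable co : {linear N -> 'rV[B]_(dim M)}.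
Hypothesis jco : free_bc j co.

Lemma bcD x y : j (x + y) = j x + j y. Proof. by case: jco => -[]. Qed.
Lemma bcZ a x : j (a *: x) = iota a *: j x. Proof. by case: jco => -[]. Qed.
Lemma bc0 : j 0 = 0.
Proof. by apply: (addrI (j 0)); rewrite -bcD !addr0. Qed.
Lemma bcB x y : j (x - y) = j x - j y.
Proof. by apply: (addIr (j y)); rewrite -bcD !subrK. Qed.
Lemma bc_sum n (F : 'I_n -> M) : j (\sum_i F i) = \sum_i j (F i).
Proof. by elim/big_rec2: _ => [|i x y _ <-]; [apply: bc0|apply: bcD]. Qed.
Lemma bcMn x n : j (x *+ n) = j x *+ n.
Proof. by rewrite -!scaler_nat bcZ rmorph_nat. Qed.

Lemma bc_co m i : co (j m) 0 i = iota (v2r m 0 i).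
Proof. by case: jco => _ -> _; rewrite mxE. Qed.

Lemma bc_inj : injective iota -> injective j.
Proof.
move=> iinj x y jxy; apply: v2r_inj; apply/rowP => i; apply: iinj.
by rewrite -!bc_co jxy.
Qed.

Definition bc_ext (P : lmodType B) (g : M -> P) (n : N) : P :=
  \sum_i co n 0 i *: g (vbase i).

Lemma bc_ext_linear (P : lmodType B) (g : M -> P) : linear (bc_ext g).
Proof.
move=> a x y; rewrite /bc_ext scaler_sumr -big_split; apply: eq_bigr => i _.
by rewrite linearP !mxE scalerDl scalerA.
Qed.

Lemma bc_extE (P : lmodType B) (g : M -> P) m : semilinear_along iota g -> bc_ext g (j m) = g m.
Proof.
move=> [gD gZ]; rewrite {2}(vbaseE m).
have g0 : g 0 = 0 by apply: (addrI (g 0)); rewrite -gD !addr0.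
have -> : g (\sum_i v2r m 0 i *: vbase i) = \sum_i iota (v2r m 0 i) *: g (vbase i).
  by elim/big_rec2: _ => // i x y _ <-; rewrite gD gZ.
by apply: eq_bigr => i _; rewrite bc_co.
Qed.

Lemma bc_uniq (P : lmodType B) (h h' : N -> P) : linear h -> linear h' ->
  (forall m, h (j m) = h' (j m)) -> h =1 h'.
Proof.
move=> hl h'l hh' n; case: jco => _ _ nE; rewrite (nE n).
have lin0 (f : N -> P) : linear f -> f 0 = 0.
  by move=> fl; have := fl (-1) 0 0; rewrite scaler0 addr0 scaleN1r addNr.
elim/big_rec: _ => [|i x _ IH]; first by rewrite !lin0.
by rewrite hl h'l hh' IH.
Qed.

Lemma free_bc_base_change : is_base_change iota j.
Proof.
split=> [|P g gsl]; first by case: jco.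
pose H := bc_ext g.
have /= [hL hLE] : exists hL : {linear N -> P}, hL =1 H.
  pose L := GRing.isLinear.Build B N P *:%R H (bc_ext_linear g).
  by exists (HB.pack_for {linear N -> P} H L).
exists hL; split=> [x|h' h'j x]; first by rewrite hLE /H bc_extE.
have gl := bc_ext_linear g.
rewrite hLE; apply: bc_uniq => [|//|m]; first exact: linearP.
by rewrite /H h'j bc_extE.
Qed.

End Theory.

(** The universal property with target B^d gives [co]. Rebuilding a vector from these coordinates
    fixes every [j m], hence is the identity by uniqueness. *)
Lemma base_change_free (M : vectType A) (N : lmodType B) (j : M -> N) :
  is_base_change iota j -> exists co, free_bc j co.
Proof.
move=> [jsl univ]; have [jD jZ] := jsl.
have [] := univ 'rV[B]_(dim M) (fun m => map_mx iota (v2r m)).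
  split=> [x y|a x]; first by rewrite linearD map_mxD.
  by rewrite linearZ map_mxZ.
move=> co [coj _]; exists co; split=> // n.
pose H n := \sum_i co n 0 i *: j (vbase i).
have Hlin : linear H.
  move=> a x y; rewrite /H scaler_sumr -big_split; apply: eq_bigr => i _.
  by rewrite linearP !mxE scalerDl scalerA.
pose hL : {linear N -> N} :=
  HB.pack_for {linear N -> N} H (GRing.isLinear.Build B N N *:%R H Hlin).
have [h0 [h0j h0u]] := univ N j jsl.
have nE : n = h0 n by apply: (h0u idfun).
rewrite {1}nE; apply/esym/(h0u hL) => m; rewrite /= /H.
have j0 : j 0 = 0 by apply: (addrI (j 0)); rewrite -jD !addr0.
rewrite [in RHS](vbaseE m); have -> : j (\sum_i v2r m 0 i *: vbase i) =
    \sum_i iota (v2r m 0 i) *: j (vbase i).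
  by elim/big_rec2: _ => // i x y _ <-; rewrite jD jZ.
by apply: eq_bigr => i _; rewrite coj mxE.
Qed.

End FreeBaseChange.

(** * Extension and descent of morphisms *)

(** What is retained of the inclusion of Sigma in S. The decomposition [re_dec] and the divisibility
    [re_frobF], whose quotient lies in [A], carry the argument. *)
Record ring_ext (p r : nat) (A B : filFrobRing) (iota : {rmorphism A -> B})
    (c : A) : Prop := RingExt {
  re_A : good_ring p r c;
  re_B : good_ring p r (iota c);
  re_inj : injective iota;
  re_fE : iota (fE A) = fE B;
  re_frob : forall x : A, iota (ffrob A x) = ffrob B (iota x);
  re_ffil : forall i (s : A), ffil i s <-> ffil i (iota s);
  re_filp : @submodule B B^o (ffil p);
  re_filpr : forall s : B, ffil p s -> ffil r s;
  re_dec : forall x : B, exists (a : A) v, x = iota a + v /\ ffil p v;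
  re_frobB : forall x : B, exists t, ffrob B x = iota t;
  re_frobF : forall x : B, ffil r x -> exists t, ffrob B x = iota t *+ p ^ r
}.

Section ScalarExtension.
Variables (p r : nat) (A B : filFrobRing) (iota : {rmorphism A -> B}) (c : A).
Hypothesis ext : ring_ext p r iota c.

Let gA := re_A ext.
Let gB := re_B ext.

Let filp0 : ffil p (0 : B). Proof. by case: (re_filp ext). Qed.
Let filpD (x y : B) : ffil p x -> ffil p y -> ffil p (x + y).
Proof. by case: (re_filp ext) => _ /(_ 1 x y); rewrite scale1r. Qed.
Let filpM (a x : B) : ffil p x -> ffil p (a * x).
Proof.
by case: (re_filp ext) => _ /(_ a x 0) + fx => /(_ fx filp0); rewrite addr0.
Qed.

Definition filp_mx n (w : 'rV[B]_n) : Prop := forall i, ffil p (w 0 i).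

(** Remainders are taken in Fil^p B although scalar extension is specified with Fil^r B: as B = A +
    Fil^p B, the submodule is the same, and membership can be read off coordinates. *)
Definition ext_along (M : filMod p r A) (N : filMod p r B) (j : M -> N) : Prop :=
  exists co : {linear N -> 'rV[B]_(dim M)}, [/\ free_bc iota j co,
    forall n, fil n <-> exists2 x, fil x & filp_mx (co (n - j x))
  & forall x, fil x -> phr (j x) = j (phr x)].

Section OneExt.
Variables (M : filMod p r A) (N : filMod p r B) (j : M -> N).
Variable co : {linear N -> 'rV[B]_(dim M)}.
Hypothesis jco : free_bc iota j co.
Hypothesis jfil : forall n, fil n <-> exists2 x, fil x & filp_mx (co (n - j x)).
Hypothesis jphr : forall x, fil x -> phr (j x) = j (phr x).

(** If [j x] is approximated by [j x'], the coordinates of [x - x'] lie in [A] and in Fil^p B, hence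
    in Fil^r A. *)
Lemma ext_fil x : fil (j x) <-> fil x.
Proof.
split=> [/jfil[x' fx' jx]|fx]; last first.
  by apply/jfil; exists x => // i; rewrite subrr linear0 mxE.
rewrite -[x](subrK x'); apply: filD => //.
rewrite (vbaseE (x - x')); apply: (fil_sum (M := M)) => i.
apply: fil_sub; apply/(re_ffil ext)/(re_filpr ext).
by rewrite -(bc_co jco) (bcB jco).
Qed.

Lemma ext_fil_filp w : filp_mx (co w) -> fil w.
Proof. by move=> wp; apply/jfil; exists 0; [apply: fil0|rewrite (bc0 jco) subr0]. Qed.

Lemma ext_phiM m : phiM (j m) = j (phiM m).
Proof.
apply: (vect_expI gB (n := 0)); rewrite !mulr1n.
have H : iota c ^+ r *: phiM (j m) = iota c ^+ r *: j (phiM m).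
  rewrite -(phiM_phr gB) -(re_fE ext) -!rmorphXn -!(bcZ jco) -(phiM_phr gA).
  by rewrite jphr//; apply: (fil_fE gA).
have [d dc] := gr_c_unit gB.
by rewrite -[LHS]scale1r -[RHS]scale1r -(expr1n _ r) -dc exprMn -!scalerA H.
Qed.

Lemma ext_phr_filp w : filp_mx (co w) ->
  exists t : 'I_(dim M) -> A, phr w = j (\sum_i t i *: phiM (vbase i)).
Proof.
move=> wp; have [t tE] := choice (fun i => re_frobF ext (re_filpr ext (wp i))).
exists t; apply: (vect_expI gB (n := r)).
rewrite (phr_phiM gB (ext_fil_filp wp)).
have -> : phiM w = phiM (\sum_i co w 0 i *: j (vbase i)) by case: jco => _ _ <-.
rewrite (phiM_sum gB) (bc_sum jco) -sumrMnl; apply: eq_bigr => i _.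
by rewrite ext_phiM tE (bcZ jco (t i)) -scalerMnl.
Qed.

End OneExt.

Section TwoExt.
Variables (M M' : filMod p r A) (N N' : filMod p r B).
Variables (j : M -> N) (j' : M' -> N').
Hypotheses (je : ext_along j) (j'e : ext_along j').

Lemma ext_hom_eq (h h' : N -> N') : linear h -> linear h' ->
  (forall m, h (j m) = h' (j m)) -> h =1 h'.
Proof. by case: je => co [jco _ _]; apply: (bc_uniq jco). Qed.

Lemma filMod_homE (C : filFrobRing) (P Q : filMod p r C) (f : P -> Q) :
  is_filMod_hom f <-> [/\ linear f, forall x, fil x -> fil (f x)
    & forall x, fil x -> phr (f x) = f (phr x)].
Proof.
split=> -[fl ff fp]; split=> // x.
  move=> fx; have := fp (exist _ x fx) (exist _ (f x) (ff x fx)) erefl.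
  by rewrite !phrE.
by move=> y yE; rewrite !phrE yE fp//; apply: svalP.
Qed.

(** [M] is generated by the [phr x], and f(j(phr x)) = phr(f(j x)). Since f(j x) is some j' x' plus
    a vector with coordinates in Fil^p B, its phi_r lies in the image of j'; so [f] descends. *)
Lemma ext_hom_full (f : N -> N') : is_filMod_hom f ->
  exists2 f0 : M -> M', is_filMod_hom f0 & forall m, f (j m) = j' (f0 m).
Proof.
move=> /filMod_homE[fl ff fp].
have [co [jco jfil jphr]] := je; have [co' [jco' jfil' jphr']] := j'e.
pose fL : {linear N -> N'} :=
  HB.pack_for {linear N -> N'} f (GRing.isLinear.Build B N N' *:%R f fl).
have key m : exists m', f (j m) = j' m'.
  have := phr_gen m; move: m; apply: span_of_ind.
  - by exists 0; rewrite (bc0 jco) (bc0 jco') [LHS](linear0 fL).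
  - move=> x y [x' xE] [y' yE]; exists (x' + y').
    by rewrite (bcD jco) (bcD jco') [LHS](linearD fL) /= xE yE.
  move=> a _ [x fx ->].
  suff [z zE] : exists z, f (j (phr x)) = j' z.
    by exists (a *: z); rewrite (bcZ jco) (bcZ jco') [LHS](linearZZ fL) /= zE.
  have fjx : fil (j x) by apply/(ext_fil jco jfil).
  rewrite -jphr// -fp//; have /jfil'[x' fx' wp] := ff _ fjx.
  have fw := ext_fil_filp jco' jfil' wp.
  have [t tE] := ext_phr_filp jco' jfil' jphr' wp.
  exists (phr x' + \sum_i t i *: phiM (vbase i)).
  rewrite (bcD jco') -tE -jphr'// -phrD ?[_ + (_ - _)]addrC ?subrK//.
  by apply/(ext_fil jco' jfil').
have [f0 f0E] := choice key; have iinj := re_inj ext.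
exists f0 => //; apply/filMod_homE; split=> [a x y|x fx|x fx].
- apply: (bc_inj jco' iinj); rewrite -f0E (bcD jco) (bcZ jco) fl !f0E.
  by rewrite (bcD jco') (bcZ jco').
- by apply/(ext_fil jco' jfil'); rewrite -f0E; apply/ff/(ext_fil jco jfil).
- apply: (bc_inj jco' iinj); rewrite -f0E -jphr// -fp; last exact/(ext_fil jco jfil).
  by rewrite f0E jphr'//; apply/(ext_fil jco' jfil'); rewrite -f0E; apply/ff/(ext_fil jco jfil).
Qed.

(** Compatibility with phi_r is checked after multiplication by p^r, that is, for phi; being
    semilinear and defined everywhere, phi can be compared on a basis. *)
Lemma ext_hom_ext (g : M -> M') : is_filMod_hom g ->
  exists2 h : N -> N', is_filMod_hom h & forall m, h (j m) = j' (g m).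
Proof.
move=> /filMod_homE[gl gf gp].
have [co [jco jfil jphr]] := je; have [co' [jco' jfil' jphr']] := j'e.
pose gL : {linear M -> M'} :=
  HB.pack_for {linear M -> M'} g (GRing.isLinear.Build A M M' *:%R g gl).
have jgs : semilinear_along iota (fun m => j' (g m)).
  split=> [x y|a x]; first by rewrite -(bcD jco') -[X in _ = j' X](linearD gL).
  by rewrite -(bcZ jco') -[X in _ = j' X](linearZZ gL).
pose h := bc_ext co (fun m => j' (g m)).
have hj m : h (j m) = j' (g m) by rewrite /h (bc_extE jco).
have hl : linear h := bc_ext_linear co _.
pose hL : {linear N -> N'} :=
  HB.pack_for {linear N -> N'} h (GRing.isLinear.Build B N N' *:%R h hl).
have gphiM m : g (phiM m) = phiM (g m).
  rewrite /phiM [LHS](linearZZ gL) /= -gp; last exact: (fil_fE gA).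
  by congr (_ *: phr _); apply: (linearZZ gL).
have hphiM n : h (phiM n) = phiM (h n).
  have [_ _ nE] := jco; rewrite {1}(nE n) (phiM_sum gB) [LHS](linear_sum hL) /=.
  rewrite {2}/h /bc_ext (phiM_sum gB); apply: eq_bigr => i _.
  rewrite [LHS](linearZZ hL) /=; congr (_ *: _).
  by rewrite (ext_phiM jco jphr) hj gphiM (ext_phiM jco' jphr').
have hf n : fil n -> fil (h n).
  move=> /jfil[x fx wp]; apply/jfil'; exists (g x); first exact: gf.
  rewrite -hj -[h n - _](linearB hL) /= /h /bc_ext linear_sum => i.
  rewrite summxE; elim/big_rec: _ => // l y _; apply: filpD.
  by rewrite linearZ mxE mulrC; apply: filpM.
exists h => //; apply/filMod_homE; split=> // n fn.
apply: (vect_expI gB (n := r)); rewrite (phr_phiM gB (hf _ fn)) -hphiM.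
by rewrite -(phr_phiM gB fn) [LHS](raddfMn hL).
Qed.

End TwoExt.
End ScalarExtension.

(** * Submodules of k[u]^d *)

Section PolySubmodule.
Variable k : fieldType.

(** A nonzero value of least degree divides all others, by Euclidean division. The values are taken
    through a map [f] so that the first coordinate of vectors can be treated directly. *)
Lemma poly_ideal_min (T : Type) (L : set T) (f : T -> {poly k}) (x0 : T) : L x0 ->
  (forall x y (q : {poly k}), L x -> L y -> exists2 z, L z & f z = f x - q * f y) ->
  exists2 y, L y & forall x, L x -> exists q, f x = q * f y.
Proof.
move=> Lx0 Lsub.
have [nz|z] := pselect (exists2 x, L x & f x != 0); last first.
  exists x0 => // x Lx; exists 0; rewrite mul0r; apply: contrapT => /eqP fx0.
  by apply: z; exists x.
pose P n := `[< exists x, [/\ L x, f x != 0 & size (f x) = n] >].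
have exP : exists n, P n.
  by have [x Lx fx0] := nz; exists (size (f x)); apply/asboolP; exists x.
case: (ex_minnP exP) => n /asboolP[y [Ly fy0 sy]] min; exists y => // x Lx.
have [z Lz fz] := Lsub x y (f x %/ f y) Lx Ly.
exists (f x %/ f y); apply/eqP; rewrite -subr_eq0 -fz; apply: contraT => fz0.
have /min : P (size (f z)) by apply/asboolP; exists z.
rewrite leqNgt -sy fz {1}(divp_eq (f x) (f y)) addrC addKr.
by rewrite ltn_modp fy0.
Qed.

(** One element takes care of the first coordinate, induction of the vectors where it vanishes. The
    rows may be dependent: what matters is that there are only [d] of them. *)
Lemma poly_submod_gen d (L : set 'rV[{poly k}]_d) : submodule L ->
  exists M : 'M[{poly k}]_d, (forall i, L (row i M)) /\
    forall b, L b -> exists v, b = v *m M.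
Proof.
elim: d L => [|d IHd] L [L0 Ll].
  exists 0; split=> [[]//|b _]; exists 0; apply/rowP; case=> //.
have [x y q Lx Ly|y0 Ly0 y0min] :=
  @poly_ideal_min _ L (fun b : 'rV_d.+1 => b 0 0) _ L0.
  exists (- q *: y + x); first exact: Ll.
  by rewrite !mxE mulNr addrC.
pose L' : set 'rV[{poly k}]_d := [set b | L (row_mx (0 : 'M_1) b)]%classic.
have [|M' [LM' M'gen]] := IHd L'.
  split=> [|a x y Lx Ly]; first by rewrite /L' /= row_mx0.
  have : L (a *: row_mx (0 : 'M_1) x + row_mx (0 : 'M_1) y) := Ll a _ _ Lx Ly.
  by rewrite scale_row_mx add_row_mx scaler0 addr0.
exists (col_mx y0 (row_mx (0 : 'M_(d, 1)) M') : 'M_(1 + d)); split=> [i|b Lb].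
  rewrite -[i](@splitK 1 d); case: split => j /=.
    by rewrite (@rowKu _ 1 d (1 + d)) [j]ord1 row_id.
  rewrite (@rowKd _ 1 d (1 + d)) row_row_mx row0; exact: LM'.
have [q qE] := y0min b Lb.
pose b' : 'rV_(1 + d) := - q *: y0 + b.
have b'0 : lsubmx b' = 0.
  apply/rowP => i; rewrite [i]ord1 !mxE /= (_ : lshift d 0 = 0); last exact: val_inj.
  by rewrite qE mulNr addNr.
have [|v' v'E] := M'gen (rsubmx b').
  by rewrite /L' /= -b'0 hsubmxK; apply: Ll.
exists (row_mx q%:M v' : 'rV_(1 + d)).
rewrite (@mul_row_col _ 1 1 d (1 + d)) mul_scalar_mx mul_mx_row mulmx0 -v'E -b'0 hsubmxK.
by rewrite /b' addrA -scalerDl subrr scale0r add0r.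
Qed.

End PolySubmodule.

(** * Essential surjectivity *)

Section EssentialSurjectivity.
Variables (p r : nat) (A B : filFrobRing) (iota : {rmorphism A -> B}) (c : A).
Hypothesis ext : ring_ext p r iota c.
Variables (R : comNzRingType) (k : fieldType).
Variables (rho : {rmorphism R -> {poly k}}) (tau : {rmorphism R -> B}) (eR : R).
Hypothesis rho_surj : forall q, exists a, rho a = q.
Hypothesis rho_ker : forall a, rho a = 0 -> pdvd p 1 a.
Hypothesis tau_fE : tau eR = fE B.
Hypothesis tau_dec : forall x : B, exists (a : R) v x',
  x = tau a + v + x' *+ p /\ ffil p v.
Hypothesis Ac : adic (p%:R : A) A^o.
Hypothesis Bc : adic (p%:R : B) B^o.
Variable N : filMod p r B.

Let gA := re_A ext.
Let gB := re_B ext.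
Local Notation d := (dim N).
Local Notation lin f v := (\sum_i v i *: f i).

Let filp_lin (f : 'I_d -> N) (v : 'I_d -> B) : (forall i, ffil p (v i)) ->
  fil (lin f v).
Proof. by move=> vp; apply: fil_sum => i; apply/fil_sub/(re_filpr ext). Qed.

Let phr_sum (n : nat) (s : 'I_n -> B) (y : 'I_n -> N) : (forall i, fil (y i)) ->
  phr (\sum_i s i *: y i) = \sum_i ffrob B (s i) *: phr (y i).
Proof.
move=> fy; suff [] : fil (\sum_i s i *: y i) /\
  phr (\sum_i s i *: y i) = \sum_i ffrob B (s i) *: phr (y i) by [].
elim/big_rec2: _ => [|i x z _ [fz <-]]; first by split; [apply: fil0|apply: phr0].
by rewrite phr_semilin//; split=> //; apply/filD => //; apply: filZ.
Qed.

Let phr_filp n (f : 'I_n -> N) (v : 'I_n -> B) : (forall i, ffil p (v i)) ->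
  exists t : 'I_n -> A, phr (\sum_i v i *: f i) = \sum_i iota (t i) *: phiM (f i).
Proof.
move=> vp; have [t tE] := choice (fun i => re_frobF ext (re_filpr ext (vp i))).
exists t; apply: (vect_expI gB (n := r)); rewrite (phr_phiM gB); last first.
  by apply: fil_sum => i; apply/fil_sub/(re_filpr ext).
rewrite (phiM_sum gB) -sumrMnl; apply: eq_bigr => i _.
by rewrite tE -scalerMnl.
Qed.

Let fil_divp (x : N) : fil (x *+ p) -> fil x.
Proof. exact: fil_torsion. Qed.

(* Modulo [(p, Fil^p B)], [Fil^r N] is a submodule of a free [k[u]]-module of rank
   [d], hence generated by [d] elements. Lifting through [W[u]] rather than [B] makes
   [E^r N] fall into the span of the [y i] up to [p Fil^r N], with no [Fil^p] term. *)
Lemma fil_generators : exists y : 'I_d -> N,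
  [/\ forall i, fil (y i),
      forall z, fil z -> exists s v n, [/\ forall i, ffil p (v i), fil n
        & z = lin y s + lin (@vbase B N) v + n *+ p]
    & forall l, exists s n, fil n /\ fE B ^+ r *: vbase l = lin y s + n *+ p].
Proof.
pose fT (a : 'rV[R]_d) : N := r2v (map_mx tau a).
have fTD a b : fT (a + b) = fT a + fT b by rewrite /fT map_mxD linearD.
have fTZ q a : fT (q *: a) = tau q *: fT a by rewrite /fT map_mxZ linearZ.
have fT0 : fT 0 = 0 by rewrite /fT map_mx0 linear0.
have fTMn a n : fT (a *+ n) = fT a *+ n.
  by elim: n => [|n IHn]; rewrite ?mulr0n// !mulrS fTD IHn.
have fT_sum n (a : 'I_n -> 'rV[R]_d) : fT (\sum_i a i) = \sum_i fT (a i).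
  by elim/big_rec2: _ => // i x z _ <-; rewrite fTD.
pose L : set 'rV[{poly k}]_d := [set b | exists a, map_mx rho a = b /\
  exists x n, fil x /\ fT a = x + n *+ p]%classic.
have L_sub : submodule L.
  split=> [|q _ _ [a [<- [x [n [fx aE]]]]] [b [<- [z [m [fz bE]]]]]].
    exists 0; rewrite map_mx0; split=> //; exists 0, 0.
    by rewrite fT0 mul0rn addr0; split=> //; apply: fil0.
  have [q' <-] := rho_surj q; exists (q' *: a + b).
  rewrite map_mxD map_mxZ; split=> //.
  exists (tau q' *: x + z), (tau q' *: n + m); split; first exact/filD/fz/filZ.
  by rewrite fTD fTZ aE bE mulrnDl scalerDr scalerMnr addrACA.
have [M [LM Mgen]] := poly_submod_gen L_sub.
have [a aP] := choice LM.
have [y yP] := choice (fun i => (aP i).2).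
have [n nP] := choice yP.
(* The kernel of [rho] consists of multiples of p, and [fT (a i)] differs from [y i] by a multiple
   of p; so lifting a relation over k[u] costs only multiples of p. *)
have genL w : L (map_mx rho w) -> exists s m, fT w = lin y s + m *+ p.
  move=> /Mgen[v vE]; have [s sE] := choice (fun i => rho_surj (v 0 i)).
  have [u uE] : exists u, w = \sum_i s i *: a i + u *+ p.
    have uex i : exists u, w 0 i - (\sum_l s l *: a l) 0 i = u *+ p.
      have := @rho_ker (w 0 i - (\sum_l s l *: a l) 0 i).
      rewrite /pdvd expn1; apply; rewrite rmorphB.
      have -> : rho (w 0 i) = (v *m M) 0 i by rewrite -vE mxE.
      rewrite summxE rmorph_sum mxE -sumrB big1// => l _.
      have := congr1 (fun m : 'rV__ => m 0 i) (aP l).1.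
      by rewrite !mxE rmorphM sE => ->; rewrite subrr.
    have [u uP] := choice uex.
    exists (\row_i u i); apply/rowP => i; rewrite mxE mulmxnE mxE -uP.
    by rewrite addrC subrK.
  exists (fun i => tau (s i)), (\sum_i tau (s i) *: n i + fT u).
  rewrite uE fTD fTMn fT_sum mulrnDl addrA; congr (_ + _).
  rewrite -sumrMnl -big_split; apply: eq_bigr => i _.
  by rewrite fTZ (nP i).2 scalerDr scalerMnr.
exists y; split=> [i|z fz|l]; first by have [] := nP i.
  have [az azP] := choice (fun i => tau_dec (v2r z 0 i)).
  have [vz vzP] := choice azP; have [xz xzP] := choice vzP.
  have zE : z = fT (\row_i az i) + lin (@vbase B N) vz + r2v (\row_i xz i) *+ p.
    apply: v2r_inj; apply/rowP => i.
    have -> : lin (@vbase B N) vz = r2v (\row_i vz i).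
      rewrite [in RHS](row_sum_delta (\row_i vz i)) linear_sum.
      by apply: eq_bigr => l _; rewrite linearZ mxE.
    rewrite /fT -linearMn -!linearD /= r2vK !mxE mulmxnE mxE.
    exact: (xzP i).1.
  have fv : fil (lin (@vbase B N) vz) by apply: filp_lin => i; apply: (xzP i).2.
  have [|s [m sE]] := genL (\row_i az i).
    exists (\row_i az i); split=> //.
    exists (z - lin (@vbase B N) vz), (- r2v (\row_i xz i)); split; first exact: filB.
    by rewrite {1}zE mulNrn addrAC addrK addrK.
  exists s, vz, (m + r2v (\row_i xz i)).
  have zE' : z = lin y s + lin (@vbase B N) vz + (m + r2v (\row_i xz i)) *+ p.
    by rewrite {1}zE sE mulrnDl addrA; congr (_ + _); rewrite addrAC.
  split=> //; first by move=> i; apply: (xzP i).2.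
  (* The remainder lies in Fil^r N because p times it does, N / Fil^r N being torsion free. *)
  apply: fil_divp; rewrite -[_ *+ p](addKr (lin y s + lin (@vbase B N) vz)) -zE' addrC.
  by apply: filB => //; apply: filD => //; apply: fil_sum => i; apply/filZ/(nP i).1.
have fTl : fT (eR ^+ r *: delta_mx 0 l) = fE B ^+ r *: vbase l.
  by rewrite fTZ rmorphXn tau_fE /fT map_delta_mx.
have [|s [m sE]] := genL (eR ^+ r *: delta_mx 0 l).
  exists (eR ^+ r *: delta_mx 0 l); split=> //.
  exists (fE B ^+ r *: vbase l), 0; rewrite mul0rn addr0; split=> //.
  exact: (fil_fE gB).
exists s, m; rewrite -fTl; split=> //; apply: fil_divp.
rewrite -[_ *+ p](addKr (lin y s)) -sE fTl addrC; apply: filB; first exact: (fil_fE gB).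
by apply: fil_sum => i; apply/filZ/(nP i).1.
Qed.

Lemma c_inv_iota : exquo 1 (c_of p B ^+ r) = iota (exquo 1 (c_of p A ^+ r)).
Proof.
have /(congr1 iota) := c_inv gA; rewrite rmorphM rmorphXn rmorph1 => a1.
by rewrite -[LHS]mulr1 -[X in _ * X]a1 mulrCA (c_inv gB) mulr1.
Qed.

(** The A-span inside a B-module: scalars are restricted to the image of [iota], whereas [span_of]
    would admit all of [B]. *)
Inductive iota_span (X : set N) : N -> Prop :=
| iota_span0 : iota_span X 0
| iota_spanS a x y : X x -> iota_span X y -> iota_span X (iota a *: x + y).

Let iota_spanD X x y : iota_span X x -> iota_span X y -> iota_span X (x + y).
Proof.
elim=> [|a u v Xu _ IH] Xy; first by rewrite add0r.
by rewrite -addrA; apply/iota_spanS/IH.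
Qed.

Let iota_spanZ X a x : iota_span X x -> iota_span X (iota a *: x).
Proof.
elim=> [|b u v Xu _ IH]; first by rewrite scaler0; constructor.
by rewrite scalerDr scalerA -rmorphM; apply: iota_spanS.
Qed.

Let N_sep (x : N) : (forall n, pdvd p n x) -> x = 0.
Proof. by have [sep _] := adic_padic (adic_vect N Bc) => /sep. Qed.

Lemma phr_lattice : exists (y : 'I_d -> N) (co : {linear N -> 'rV[B]_d}),
  [/\ forall i, fil (y i), forall n, n = \sum_i co n 0 i *: phr (y i),
      forall s : 'rV[B]_d, co (\sum_i s 0 i *: phr (y i)) = s
    & forall z, fil z -> exists v : 'rV[A]_d,
        phr z = \sum_i iota (v 0 i) *: phr (y i)].
Proof.
have [y [fy fil_dec E_dec]] := fil_generators; pose e i := phr (y i).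
pose ci := exquo 1 (c_of p A ^+ r).
have phr_dec z : fil z -> exists (s : 'I_d -> B) t n, fil n /\ phr z =
    \sum_i ffrob B (s i) *: e i + \sum_l iota (t l) *: phiM (@vbase B N l) + phr n *+ p.
  move=> /fil_dec[s [v [n [vp fn zE]]]].
  have [t tE] := phr_filp (@vbase B N) vp; exists s, t, n; split=> //.
  have fys : fil (lin y s) by apply: fil_sum => i; apply/filZ/fy.
  have fv := filp_lin (@vbase B N) vp.
  have fnp : fil (n *+ p) by rewrite -scaler_nat; apply: filZ.
  rewrite zE phrD// ?phrD//; last exact: filD.
  by rewrite (phr_sum s fy) tE phrMn.
have phi_dec l : exists (s : 'I_d -> B) n, fil n /\ phiM (@vbase B N l) =
    iota ci *: (\sum_i ffrob B (s i) *: e i + phr n *+ p).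
  have [s [n [fn sE]]] := E_dec l; exists s, n; split=> //.
  have fnp : fil (n *+ p) by rewrite -scaler_nat; apply: filZ.
  rewrite /phiM c_inv_iota sE phrD ?phr_sum ?phrMn//.
  by apply: fil_sum => i; apply/filZ/fy.
pose ce (s : 'rV[B]_d) : N := \sum_i s 0 i *: e i.
have ceP a s t : ce (a *: s + t) = a *: ce s + ce t.
  rewrite /ce scaler_sumr -big_split; apply: eq_bigr => i _.
  by rewrite !mxE scalerDl scalerA.
pose ceL : {linear 'rV[B]_d -> N} :=
  HB.pack_for {linear 'rV[B]_d -> N} ce (GRing.isLinear.Build B _ N *:%R ce ceP).
have sum_ce (s : 'I_d -> B) : \sum_i s i *: e i = ceL (\row_i s i).
  by apply: eq_bigr => i _; rewrite mxE.
have e_gen n : exists s, n = ce s.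
  apply: (@padic_closed p _ _ setT ceL _ N_sep) => //.
    exact/adic_padic/adic_rV.
  move=> {}n _; suff [s [x' ->]] : exists s x', n = ceL s + x' *+ p by exists s, x'.
  have TD x1 x2 : (exists s x', x1 = ceL s + x' *+ p) ->
      (exists s x', x2 = ceL s + x' *+ p) -> exists s x', x1 + x2 = ceL s + x' *+ p.
    move=> [s [x' ->]] [t [y' ->]]; exists (s + t), (x' + y').
    by rewrite linearD mulrnDl addrACA.
  have TZ a x : (exists s x', x = ceL s + x' *+ p) ->
      exists s x', a *: x = ceL s + x' *+ p.
    move=> [s [x' ->]]; exists (a *: s), (a *: x').
    by rewrite linearZZ scalerDr scalerMnr.
  have T0 : exists s x', 0 = ceL s + x' *+ p.
    by exists 0, 0; rewrite linear0 mul0rn addr0.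
  have := phr_gen n; move: n; apply: span_of_ind => // a _ [z /phr_dec[s [t [m [fm ->]]]] ->].
  apply: (TZ); apply: (TD); last by exists 0, (phr m); rewrite linear0 add0r.
  apply: (TD); first by exists (\row_i ffrob B (s i)), 0; rewrite mul0rn addr0 -sum_ce.
  elim/big_rec: _ => // l x _; apply/TD/TZ.
  have [s' [m' [_ ->]]] := phi_dec l; apply: TZ.
  by exists (\row_i ffrob B (s' i)), (phr m'); rewrite -sum_ce.
pose G := \matrix_i v2r (e i).
have ceG s : v2r (ce s) = s *m G.
  rewrite linear_sum; apply/rowP => l; rewrite summxE mxE; apply: eq_bigr => i _.
  by rewrite linearZ !mxE.
have [h hE] := choice (fun l => e_gen (@vbase B N l)).
pose H := \matrix_l h l.
have HG : H *m G = 1%:M.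
  by apply/row_matrixP => l; rewrite row_mul rowK -ceG -hE r2vK row1.
(* [d] generators of a free module of rank [d] form a basis: over a commutative ring a one-sided
   inverse of a square matrix is two-sided. *)
have GH := mulmx1C HG.
pose cof (n : N) : 'rV[B]_d := v2r n *m H.
have cofP : linear cof by move=> a x z; rewrite /cof linearP mulmxDl scalemxAl.
pose coL : {linear N -> 'rV[B]_d} :=
  HB.pack_for {linear N -> 'rV[B]_d} cof (GRing.isLinear.Build B N _ *:%R cof cofP).
exists y, coL; split=> // [n|s|z fz].
- by apply: v2r_inj; rewrite -[X in _ = v2r X]/(ce (cof n)) ceG -mulmxA HG mulmx1.
- by rewrite -[X in coL X]/(ce s) /= /cof ceG -mulmxA GH mulmx1.
pose je (v : 'rV[A]_d) : N := ce (map_mx iota v).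
have jeD u v : je (u + v) = je u + je v.
  by rewrite /je map_mxD -[LHS]/(ceL _) linearD.
have jeZ a v : je (a *: v) = iota a *: je v.
  by rewrite /je map_mxZ -[LHS]/(ceL _) linearZZ.
have jeB : zmod_morphism je.
  by move=> u v; apply: (addIr (je v)); rewrite -jeD !subrK.
pose jeA : {additive 'rV[A]_d -> N} :=
  HB.pack_for {additive 'rV[A]_d -> N} je (GRing.isZmodMorphism.Build _ _ je jeB).
pose X : set N := [set x | exists2 z, fil z & x = phr z]%classic.
have Xz z' : fil z' -> iota_span X (phr z').
  move=> fz'; rewrite -[phr z']scale1r -(rmorph1 iota) -[_ *: _]addr0.
  by apply: iota_spanS; [exists z'|constructor].
suff [v vE] : exists v, phr z = je v.
  by exists v; rewrite vE; apply: eq_bigr => i _; rewrite mxE.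
(* The approximation runs on the A-span of the values of phi_r, because the remainders return
   multiplied by scalars of [A]. *)
apply: (@padic_closed p _ _ (iota_span X) jeA _ N_sep _ (phr z) (Xz _ fz)).
  exact/adic_padic/adic_rV.
pose Q x := exists v x', iota_span X x' /\ x = je v + x' *+ p.
have QD x1 x2 : Q x1 -> Q x2 -> Q (x1 + x2).
  move=> [v1 [x' [Xx' ->]]] [v2 [y' [Xy' ->]]].
  exists (v1 + v2), (x' + y'); split; first exact: iota_spanD.
  by rewrite jeD mulrnDl addrACA.
have QZ a x : Q x -> Q (iota a *: x).
  move=> [v [x' [Xx' ->]]]; exists (a *: v), (iota a *: x'); split; first exact: iota_spanZ.
  by rewrite jeZ scalerDr scalerMnr.
have je0 : je 0 = 0 by apply: (addrI (je 0)); rewrite -jeD !addr0.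
have Q0 : Q 0 by exists 0, 0; rewrite je0 mul0rn addr0; split=> //; constructor.
have Qe (s : 'I_d -> B) : Q (\sum_i ffrob B (s i) *: e i).
  have [t tE] := choice (fun i => re_frobB ext (s i)).
  exists (\row_i t i), 0; split; first by constructor.
  rewrite mul0rn addr0; apply: eq_bigr => i _; by rewrite !mxE tE.
have Qp m : fil m -> Q (phr m *+ p).
  by move=> fm; exists 0, (phr m); rewrite je0 add0r; split=> //; apply: Xz.
move=> x; elim=> [|a _ x' [z' /phr_dec[s [t [m [fm ->]]]] ->] _ IH] //.
apply: (QD _ _ (QZ a _ (QD _ _ (QD _ _ (Qe s) _) (Qp m fm))) IH).
elim/big_rec: _ => // l u _; apply/QD/QZ.
have [s' [m' [fm' ->]]] := phi_dec l; apply/QZ/QD; [exact: Qe|exact: Qp].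
Qed.

Lemma ext_along_surj : exists (M : filMod p r A) (j : M -> N), ext_along iota j.
Proof.
have [y [co0 [fy co0E co0K lattice]]] := phr_lattice.
pose V : vectType A := 'rV[A]_d; pose e i := phr (y i).
pose j (v : V) : N := \sum_i iota (v 0 i) *: e i.
have jE v : j v = \sum_i (map_mx iota v) 0 i *: e i.
  by apply: eq_bigr => i _; rewrite mxE.
have coj v : co0 (j v) = map_mx iota v by rewrite jE co0K.
have jinj : injective j.
  move=> u v juv; apply/rowP => i; apply: (re_inj ext).
  by have := congr1 (fun w : 'rV_d => w 0 i) (congr1 co0 juv); rewrite !coj !mxE.
have jD u v : j (u + v) = j u + j v.
  by rewrite /j -big_split; apply: eq_bigr => i _; rewrite mxE rmorphD scalerDl.
have jZ a v : j (a *: v) = iota a *: j v.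
  by rewrite /j scaler_sumr; apply: eq_bigr => i _; rewrite mxE rmorphM scalerA.
have j0 : j 0 = 0 by apply: (addrI (j 0)); rewrite -jD !addr0.
have jMn v n : j (v *+ n) = j v *+ n by rewrite -!scaler_nat jZ rmorph_nat.
have j_sum n (u : 'I_n -> V) : j (\sum_i u i) = \sum_i j (u i).
  by elim/big_rec2: _ => // i u1 u2 _ <-; rewrite jD.
have j_delta i : j (delta_mx 0 i) = e i.
  rewrite /j (bigD1 i) //= mxE !eqxx rmorph1 scale1r big1 ?addr0// => l li.
  by rewrite mxE eqxx (negPf li) rmorph0 scale0r.
have lat z : fil z -> exists v, phr z = j v by move=> /lattice[v ->]; exists v.
pose ci := exquo 1 (c_of p A ^+ r).
have fex v : exists w, phiM (j v) = j w.
  have [w wE] := lat _ (fil_fE gB (j v)).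
  by exists (ci *: w); rewrite /phiM c_inv_iota wE jZ.
have [f fjE] := choice fex.
pose F : set V := [set v | fil (j v)]%classic.
have F_sub : submodule F.
  split=> [|a u v Fu Fv]; rewrite /F /=; first by rewrite j0; apply: fil0.
  by rewrite jD jZ; apply/filD/Fv/filZ.
have FA (s : A) v : ffil r s -> F (s *: v).
  by move=> rs; rewrite /F /= jZ; apply/fil_sub/(re_ffil ext).
have f_semi (a : A) u v : f (a *: u + v) = ffrob A a *: f u + f v.
  apply: jinj; rewrite -fjE !jD !jZ (phiM_semilin gB) -!fjE.
  by rewrite (re_frob ext).
have f_div v : F v -> exists z, f v = z *+ p ^ r.
  move=> Fv; have [z zE] := lat _ Fv; exists z; apply: jinj.
  by rewrite -fjE -(phr_phiM gB Fv) zE jMn.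
have F_tors v : F (v *+ p) -> F v by rewrite /F /= jMn; apply: fil_torsion.
pose gens : set V := [set z | exists2 x, F x & z *+ p ^ r = f x]%classic.
have gensP v z : F v -> j z = phr (j v) -> gens z.
  by move=> Fv zE; exists v => //; apply: jinj; rewrite jMn zE (phr_phiM gB Fv) fjE.
(* [y i] may lie outside the image of [j]. Write y_i = j x + w with w in Fil^p N: then phi_r(w) is
   an A-combination of the phi(e_l) = c^-r phi_r(E^r e_l), and E^r e_l does come from [F]. *)
have f_gen v : span_of gens v.
  suff gen_delta i : span_of gens (delta_mx 0 i).
    by rewrite (row_sum_delta v); apply: span_of_sum => i; apply: span_ofZ.
  have [x xP] := choice (fun l => re_dec ext (co0 (y i) 0 l)).
  have [w wP] := choice xP.
  have yE : y i = j (\row_l x l) + \sum_l w l *: e l.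
    rewrite {1}(co0E (y i)) jE -big_split; apply: eq_bigr => l _.
    by rewrite !mxE (wP l).1 scalerDl.
  have fw : fil (\sum_l w l *: e l) by apply: filp_lin => l; apply: (wP l).2.
  have fx : fil (j (\row_l x l)).
    by rewrite -[j _](addrK (\sum_l w l *: e l)) -yE; apply: filB.
  have [t tE] := phr_filp e (fun l => (wP l).2).
  have [z zE] := lat _ fx.
  have [h hE] := choice (fun l => lat _ (fil_fE gB (e l))).
  have -> : delta_mx 0 i = z + \sum_l t l *: (ci *: h l).
    apply: jinj; rewrite j_delta jD j_sum -zE /e {1}yE phrD// tE; congr (_ + _).
    by apply: eq_bigr => l _; rewrite !jZ -hE -c_inv_iota.
  apply: span_ofD; first by apply/span_of_gen/gensP/esym/zE.
  apply: span_of_sum => l; apply/span_ofZ/span_ofZ/span_of_gen.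
  apply: (@gensP (fE A ^+ r *: delta_mx 0 l)); first exact/FA/(gr_fE gA).
  by rewrite jZ j_delta rmorphXn (re_fE ext) -hE.
pose M := mk_filMod gA F_sub FA f_semi f_div f_gen F_tors.
(* [T] passes from the visible coordinates of a row vector to those of its [vectType] structure, in
   which [free_bc] is phrased. *)
pose T : 'M[A]_(d, dim V) := \matrix_i v2r (delta_mx 0 i : V).
have vT (v : V) : v2r v = v *m T.
  rewrite {1}(row_sum_delta v) linear_sum; apply/rowP => l.
  rewrite summxE mxE; apply: eq_bigr => i _.
  by rewrite linearZ !mxE.
pose cof (n : N) : 'rV[B]_(dim V) := co0 n *m map_mx iota T.
have cofP : linear cof by move=> a u v; rewrite /cof linearP mulmxDl scalemxAl.
pose co : {linear N -> 'rV[B]_(dim V)} :=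
  HB.pack_for {linear N -> 'rV[B]_(dim V)} cof (GRing.isLinear.Build B N _ *:%R cof cofP).
have co_lin n : co n = co0 n *m map_mx iota T by [].
have nE n : n = \sum_i co n 0 i *: j (vbase i).
  pose H n := \sum_i co n 0 i *: j (vbase i).
  have HD u v : H (u + v) = H u + H v.
    by rewrite /H -big_split; apply: eq_bigr => i _; rewrite linearD mxE scalerDl.
  have HZ a u : H (a *: u) = a *: H u.
    by rewrite /H scaler_sumr; apply: eq_bigr => i _; rewrite linearZ mxE scalerA.
  have Hj v : H (j v) = j v.
    rewrite {2}(vbaseE v) j_sum; apply: eq_bigr => i _.
    by rewrite jZ co_lin coj -map_mxM -vT mxE.
  have H0 : H 0 = 0 by apply: (addrI (H 0)); rewrite -HD !addr0.
  rewrite -[RHS]/(H n) (co0E n); elim/big_rec: _ => // i x _ IH.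
  by rewrite HD HZ -IH -[phr _]/(e i) -j_delta Hj.
exists M, j, co; split=> [|n|v Fv].
- split=> // v; first by rewrite co_lin coj -map_mxM -vT.
- split=> [fn|[x Fx wp]]; last first.
    rewrite -[n](subrK (j x)); apply: filD => //; rewrite (nE (n - j x)).
    by apply: fil_sum => i; apply/fil_sub/(re_filpr ext).
  have [x xP] := choice (fun l => re_dec ext (co0 n 0 l)).
  have [w wP] := choice xP.
  have nxE : n = j (\row_l x l) + \sum_l w l *: e l.
    rewrite {1}(co0E n) jE -big_split; apply: eq_bigr => l _.
    by rewrite !mxE (wP l).1 scalerDl.
  exists (\row_l x l).
    rewrite /= /F /= -[j _](addrK (\sum_l w l *: e l)) -nxE; apply: filB => //.
    by apply: filp_lin => l; apply: (wP l).2.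
  move=> i; rewrite co_lin linearB coj mxE.
  have [fp0 fpl] := re_filp ext.
  have fpD (a b : B) : ffil p a -> ffil p b -> ffil p (a + b).
    by move=> fa fb; have := fpl 1 _ _ fa fb; rewrite scale1r.
  elim/big_rec: _ => // l u _; apply: fpD.
  rewrite !mxE (wP l).1 addrC addKr.
  by rewrite mulrC -[_ * _]addr0; apply: (fpl _ _ _ (wP l).2 fp0).
- apply: (@vect_expI _ _ _ _ gB N _ _ r).
  by rewrite (phr_phiM gB Fv) -jMn (mk_phr gA) // -fjE.
Qed.

End EssentialSurjectivity.

(** * Existence of the extended object and its intrinsic description *)

Section ScalarExtensionObject.
Variables (p r : nat) (A B : filFrobRing) (iota : {rmorphism A -> B}) (c : A).
Hypothesis ext : ring_ext p r iota c.

Let gA := re_A ext.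
Let gB := re_B ext.

Let filp0 : ffil p (0 : B). Proof. by case: (re_filp ext). Qed.
Let filpD (x y : B) : ffil p x -> ffil p y -> ffil p (x + y).
Proof. by case: (re_filp ext) => _ /(_ 1 x y); rewrite scale1r. Qed.
Let filpM (a x : B) : ffil p x -> ffil p (a * x).
Proof.
by case: (re_filp ext) => _ /(_ a x 0) + fx => /(_ fx filp0); rewrite addr0.
Qed.
Let filpMr (a x : B) : ffil p x -> ffil p (x * a).
Proof. by rewrite mulrC; apply: filpM. Qed.

Section FilBC.
Variables (M : filMod p r A) (N : lmodType B) (j : M -> N).
Variable co : {linear N -> 'rV[B]_(dim M)}.
Hypothesis jco : free_bc iota j co.

Definition fil_bc : set N :=
  [set n | exists2 x, fil x & filp_mx p (co (n - j x))]%classic.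

Let filp_mxD (u v : 'rV[B]_(dim M)) : filp_mx p u -> filp_mx p v -> filp_mx p (u + v).
Proof. by move=> up vp i; rewrite mxE; apply: filpD. Qed.

Let filp_mxZ a (u : 'rV[B]_(dim M)) : filp_mx p u -> filp_mx p (a *: u).
Proof. by move=> up i; rewrite mxE; apply: filpM. Qed.

Let filp_mxZl a (u : 'rV[B]_(dim M)) : ffil p a -> filp_mx p (a *: u).
Proof. by move=> ap i; rewrite mxE; apply: filpMr. Qed.

Lemma filp_j_fil m : filp_mx p (co (j m)) -> fil m.
Proof.
move=> mp; rewrite (vbaseE m); apply: (fil_sum (M := M)) => i.
apply: fil_sub; apply/(re_ffil ext)/(re_filpr ext).
by rewrite -(bc_co jco).
Qed.

Lemma bc_decomp n : exists m, filp_mx p (co (n - j m)).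
Proof.
have [x xP] := choice (fun l => re_dec ext (co n 0 l)).
exists (r2v (\row_l x l)) => i; case: jco => _ coj _.
rewrite linearB coj r2vK !mxE; have [v [-> vp]] := xP i.
by rewrite addrC addKr.
Qed.

Lemma fil_bc_j x : fil x -> fil_bc (j x).
Proof. by exists x => // i; rewrite subrr linear0 mxE. Qed.

Lemma fil_bcD u v : fil_bc u -> fil_bc v -> fil_bc (u + v).
Proof.
move=> [x fx xp] [y fy yp]; exists (x + y); first exact: filD.
by rewrite (bcD jco) opprD addrACA linearD; apply: filp_mxD.
Qed.

Lemma fil_bcZ a u : fil_bc u -> fil_bc (a *: u).
Proof.
move=> [x fx xp]; have [b [v [-> vp]]] := re_dec ext a.
exists (b *: x); first exact: filZ.
have -> : (iota b + v) *: u - j (b *: x) = iota b *: (u - j x) + v *: u.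
  by rewrite (bcZ jco) scalerDl scalerBr addrAC.
by rewrite linearD !linearZ; apply: filp_mxD; [apply: filp_mxZ|apply: filp_mxZl].
Qed.

Lemma fil_bc_submod : submodule fil_bc.
Proof.
split; first by rewrite -(bc0 jco); apply/fil_bc_j/fil0.
by move=> a u v uF vF; apply/fil_bcD/vF/fil_bcZ.
Qed.

(** Reducing both factors modulo Fil^p leaves [j (b *: m)], where b lies in Fil^r A because it
    differs from s by an element of Fil^p B. *)
Lemma fil_bc_sub (s : B) n : ffil r s -> fil_bc (s *: n).
Proof.
move=> rs; have [b [v [sE vp]]] := re_dec ext s.
have rb : ffil r b.
  apply/(re_ffil ext); have [f0 fl] := gr_fil gB.
  have -> : iota b = (-1) *: (v : B^o) + s by rewrite sE scaleN1r addrC addrK.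
  exact/fl/rs/(re_filpr ext).
have [m mp] := bc_decomp n; exists (b *: m); first exact: fil_sub.
have -> : s *: n - j (b *: m) = iota b *: (n - j m) + v *: n.
  by rewrite sE (bcZ jco) scalerDl scalerBr addrAC.
by rewrite linearD !linearZ; apply: filp_mxD; [apply: filp_mxZ|apply: filp_mxZl].
Qed.

(** Modulo Fil^p the vector is some [j m]; then [m *+ p] lies in Fil^r M up to coordinates in Fil^p,
    and torsion-freeness of M / Fil^r M gives [m] in Fil^r M. *)
Lemma fil_bc_tors n : fil_bc (n *+ p) -> fil_bc n.
Proof.
move=> [x fx xp]; have [m mp] := bc_decomp n; exists m => //.
apply: fil_torsion; rewrite -[m *+ p](subrK x); apply: filD => //.
apply: filp_j_fil; rewrite (bcB jco) (bcMn jco).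
have -> : j m *+ p - j x = (-1) *: ((n - j m) *+ p) + (n *+ p - j x).
  by rewrite scaleN1r mulrnBl opprB addrA subrK.
rewrite linearD linearZ; apply: filp_mxD => //; apply: filp_mxZ.
by rewrite -scaler_nat linearZ; apply: filp_mxZ.
Qed.

End FilBC.

Lemma ext_along_exists (M : filMod p r A) :
  exists (N : filMod p r B) (j : M -> N), ext_along iota j.
Proof.
pose V : vectType B := 'rV[B]_(dim M).
pose j (m : M) : V := map_mx iota (v2r m).
have jco : free_bc iota j (idfun : {linear V -> 'rV[B]_(dim M)}).
  split=> [|//|n].
    split=> [x y|a x]; first by rewrite /j linearD map_mxD.
    by rewrite /j linearZ map_mxZ.
  rewrite {1}(row_sum_delta n); apply: eq_bigr => i _.
  by rewrite /j r2vK map_delta_mx.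
pose f (v : V) : V := \sum_i ffrob B (v 0 i) *: j (phiM (vbase i)).
have f_semi (a : B) u v : f (a *: u + v) = ffrob B a *: f u + f v.
  rewrite /f scaler_sumr -big_split; apply: eq_bigr => i _.
  by rewrite !mxE rmorphD rmorphM scalerDl scalerA.
have fj m : f (j m) = j (phiM m).
  rewrite {2}(vbaseE m) (phiM_sum gA) (bc_sum jco); apply: eq_bigr => i _.
  by rewrite [RHS](bcZ jco) mxE (re_frob ext).
have f_div v : fil_bc j idfun v -> exists z, f v = z *+ p ^ r.
  move=> [x fx xp]; have [t tE] := choice (fun i => re_frobF ext (re_filpr ext (xp i))).
  exists (j (phr x) + \sum_i iota (t i) *: j (phiM (vbase i))).
  rewrite mulrnDl -(bcMn jco) (phr_phiM gA fx) -fj -sumrMnl addrC.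
  rewrite -[v in LHS](subrK (j x)) -[v - _]scale1r f_semi rmorph1 scale1r.
  by congr (_ + _); apply: eq_bigr => i _; rewrite tE -scalerMnl.
have f_gen v : span_of
    [set z | exists2 x, fil_bc j idfun x & z *+ p ^ r = f x]%classic v.
  have [_ _ nE] := jco; rewrite (nE v); apply: span_of_sum => i; apply: span_ofZ.
  have := phr_gen (vbase i : M); move: (vbase i); apply: span_of_ind => [|x y|a _ [x fx ->]].
  - by rewrite (bc0 jco); apply: span_of0.
  - by rewrite (bcD jco); apply: span_ofD.
  rewrite (bcZ jco); apply/span_ofZ/span_of_gen; exists (j x); first exact: fil_bc_j.
  by rewrite -(bcMn jco) (phr_phiM gA fx) fj.
pose N := mk_filMod gB (fil_bc_submod jco) (fil_bc_sub jco) f_semi f_div f_gen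
  (fil_bc_tors jco).
exists N, j, idfun; split=> // x fx.
have Fx : fil_bc j idfun (j x) by apply: fil_bc_j.
apply: (@vect_expI _ _ _ _ gB N _ _ r).
by rewrite (mk_phr gB) // fj -(phr_phiM gA fx) (bcMn jco).
Qed.

Section Characterization.
Variables (M : filMod p r A) (N : filMod p r B) (j : M -> N).

Definition scalar_ext_fil : Prop := forall y : N, fil y <->
  exists a b : N, [/\ y = a + b, span_of [set n | exists2 x, fil x & n = j x]%classic a
    & span_of [set n | exists (s : B) (m : N), ffil r s /\ n = s *: m]%classic b].

Definition scalar_ext_phir : Prop :=
  forall (x : {x : M | fil x}) (y : {y : N | fil y}),
    sval y = j (sval x) -> phir y = j (phir x).

(** Bridge from the specification of scalar extension to the coordinate form; [fil_bc_sub] turns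
    multiples by Fil^r B into Fil^p remainders. *)
Lemma ext_alongP : ext_along iota j <->
  [/\ is_base_change iota j, scalar_ext_fil & scalar_ext_phir].
Proof.
split=> [[co [jco jfil jphr]]|[jbc jfil jphir]].
  split; first exact: free_bc_base_change jco.
    move=> y; split=> [/jfil[x fx xp]|[a [b [-> aP bP]]]].
      exists (j x), (y - j x); split; first by rewrite addrC subrK.
        by apply: span_of_gen; exists x.
      have [_ _ nE] := jco; rewrite (nE (y - j x)); apply: span_of_sum => i; apply: span_of_gen.
      by exists (co (y - j x) 0 i), (j (vbase i)); split=> //; apply: (re_filpr ext).
    apply: filD.
      elim/span_of_ind: a / aP => [|u v|s _ [x fx ->]]; [exact: fil0|exact: filD|].
      by apply/filZ/jfil; exists x => // i; rewrite subrr linear0 mxE.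
    elim/span_of_ind: b / bP => [|u v|s _ [t [m [rt ->]]]]; [exact: fil0|exact: filD|].
    exact/filZ/fil_sub.
  by move=> x y yE; rewrite !phrE yE jphr//; apply: svalP.
have [co jco] := base_change_free jbc; exists co.
have fj x : fil x -> fil (j x).
  move=> fx; apply/jfil; exists (j x), 0; rewrite addr0; split=> //.
    by apply: span_of_gen; exists x.
  exact: span_of0.
split=> // [n|x fx].
  split=> [/jfil[a [b [-> aP bP]]]|[x fx xp]].
    apply: (fil_bcD jco).
      elim/span_of_ind: a / aP => [|u v|s _ [x fx ->]].
      - by have [] := fil_bc_submod jco.
      - exact: (fil_bcD jco).
      - exact/(fil_bcZ jco)/fil_bc_j.
    elim/span_of_ind: b / bP => [|u v|s _ [t [m [rt ->]]]].
    - by have [] := fil_bc_submod jco.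
    - exact: (fil_bcD jco).
    - exact/(fil_bcZ jco)/(fil_bc_sub jco).
  rewrite -[n](subrK (j x)); apply: filD; last exact: fj.
  have [_ _ nE] := jco; rewrite (nE (n - j x)); apply: fil_sum => i.
  by apply/fil_sub/(re_filpr ext).
have := jphir (exist _ x fx) (exist _ (j x) (fj x fx)) erefl.
by rewrite !phrE.
Qed.

End Characterization.
End ScalarExtensionObject.

(** * From modules to the equivalence of categories *)

(** Preimages of objects, isomorphisms and morphisms are all chosen; faithfulness makes the chosen
    preimages of morphisms functorial. *)
Lemma full_faithful_equivalence (C D : category) (F : functor C D) :
  (forall (X Y : C) (f : Defs.hom (F X) (F Y)), exists g : Defs.hom X Y, fmap F g = f) ->
  (forall (X Y : C) (g g' : Defs.hom X Y), fmap F g = fmap F g' -> g = g') ->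
  (forall Y : D, exists (X : C) (u : Defs.hom (F X) Y) (v : Defs.hom Y (F X)),
     compose v u = idm (F X) /\ compose u v = idm Y) ->
  equivalence F.
Proof.
move=> full faith surj.
pose G Y := projT1 (cid (surj Y)).
have exu Y : exists (u : Defs.hom (F (G Y)) Y) (v : Defs.hom Y (F (G Y))),
    compose v u = idm (F (G Y)) /\ compose u v = idm Y.
  exact: projT2 (cid (surj Y)).
pose u Y := projT1 (cid (exu Y)).
have exv Y : exists v : Defs.hom Y (F (G Y)),
    compose v (u Y) = idm (F (G Y)) /\ compose (u Y) v = idm Y.
  exact: projT2 (cid (exu Y)).
pose v Y := projT1 (cid (exv Y)).
have vu Y : compose (v Y) (u Y) = idm (F (G Y)) by have [] := projT2 (cid (exv Y)).
have uv Y : compose (u Y) (v Y) = idm Y by have [] := projT2 (cid (exv Y)).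
pose lift X Y (f : Defs.hom (F X) (F Y)) : Defs.hom X Y := projT1 (cid (full X Y f)).
have liftE X Y (f : Defs.hom (F X) (F Y)) : fmap F (lift X Y f) = f.
  exact: projT2 (cid (full X Y f)).
pose Gm Y Z (f : Defs.hom Y Z) : Defs.hom (G Y) (G Z) :=
  lift _ _ (compose (v Z) (compose f (u Y))).
have Gid Y : Gm Y Y (idm Y) = idm (G Y).
  by apply: faith; rewrite liftE fmap_id comp_idl vu.
have Gcomp Y Z T (g : Defs.hom Z T) (f : Defs.hom Y Z) :
    Gm Y T (compose g f) = compose (Gm Z T g) (Gm Y Z f).
  apply: faith; rewrite fmap_comp !liftE -!Defs.compA; congr (compose _ (compose _ _)).
  by rewrite [RHS]Defs.compA uv comp_idl.
exists (Functor Gid Gcomp); split.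
  exists (fun X => lift _ _ (u (F X))), (fun X => lift _ _ (v (F X))); split.
  - move=> X Y f; apply: faith; rewrite /= /Gm !fmap_comp !liftE.
    by rewrite Defs.compA uv comp_idl.
  - move=> X Y f; apply: faith; rewrite /= /Gm !fmap_comp !liftE -!Defs.compA.
    by rewrite uv comp_idr.
  - by move=> X; apply: faith; rewrite fmap_comp !liftE fmap_id vu.
  - by move=> X; apply: faith; rewrite fmap_comp !liftE fmap_id uv.
exists u, v; split=> //.
- by move=> Y Z f /=; rewrite /Gm liftE Defs.compA uv comp_idl.
- by move=> Y Z f /=; rewrite /Gm liftE -!Defs.compA uv comp_idr.
Qed.

Section ScalarExtensionFunctor.
Variables (p r : nat) (A B : filFrobRing) (iota : {rmorphism A -> B}) (c : A).
Hypothesis ext : ring_ext p r iota c.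

Lemma filMod_hom_linear (C : filFrobRing) (M N : filMod p r C) (f : filMod_hom M N) :
  linear (sval f).
Proof. by case: (svalP f). Qed.

(** Extensions of objects and morphisms are chosen; the functor laws hold because a B-linear map is
    determined by its values on the image of [j]. *)
Lemma scalar_extension_exists :
  exists F : functor (ModPhi p r A) (ModPhi p r B), is_scalar_extension iota F.
Proof.
pose N M := projT1 (cid (ext_along_exists ext M)).
have exj (M : filMod p r A) : exists j : M -> N M, ext_along iota j.
  exact: projT2 (cid (ext_along_exists ext M)).
pose j M := projT1 (cid (exj M)).
have je (M : filMod p r A) : ext_along iota (j M) by exact: projT2 (cid (exj M)).
have exm (M M' : filMod p r A) (f : filMod_hom M M') :
    exists h : filMod_hom (N M) (N M'), forall m, sval h (j M m) = j M' (sval f m).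
  have [h hP hj] := ext_hom_ext ext (je M) (je M') (svalP f).
  by exists (exist _ h hP).
pose Fm (M M' : filMod p r A) (f : filMod_hom M M') := projT1 (cid (exm M M' f)).
have FmE (M M' : filMod p r A) (f : filMod_hom M M') m : sval (Fm M M' f) (j M m) = j M' (sval f m).
  exact: projT2 (cid (exm M M' f)) m.
have homP (M M' : filMod p r A) (h h' : filMod_hom (N M) (N M')) :
    (forall m, sval h (j M m) = sval h' (j M m)) -> h = h'.
  move=> hh'; apply: filMod_homP.
  by apply: (ext_hom_eq (je M)) hh'; apply: filMod_hom_linear.
have Fid (M : filMod p r A) : Fm M M (filMod_id M) = filMod_id (N M).
  by apply: homP => m; rewrite FmE.
have Fcomp (M M' M'' : filMod p r A) (g : filMod_hom M' M'') (f : filMod_hom M M') :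
    Fm M M'' (filMod_comp g f) = filMod_comp (Fm M' M'' g) (Fm M M' f).
  by apply: homP => m; rewrite FmE /= !FmE.
exists (@Functor (ModPhi p r A) (ModPhi p r B) N Fm Fid Fcomp), j.
split=> [M|M y|M x y|M M' f x].
- by have /(ext_alongP ext)[] := je M.
- by have /(ext_alongP ext)[_ + _] := je M; apply.
- by have /(ext_alongP ext)[_ _ +] := je M; apply.
- exact: FmE.
Qed.

Hypothesis surj : forall N : filMod p r B,
  exists (M : filMod p r A) (j : M -> N), ext_along iota j.

Lemma scalar_extension_equivalence (F : functor (ModPhi p r A) (ModPhi p r B)) :
  is_scalar_extension iota F -> equivalence F.
Proof.
move=> [j [jbc jfil jphir jm]].
have je (M : filMod p r A) : ext_along iota (j M).
  by apply/(ext_alongP ext); split; [apply: jbc|apply: jfil|apply: jphir].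
apply: full_faithful_equivalence => [M M' f|M M' g g' gg'|N].
- have [f0 f0P f0E] := ext_hom_full ext (je M) (je M') (svalP f).
  exists (exist _ f0 f0P); apply: filMod_homP; apply: (ext_hom_eq (je M)).
  + exact: filMod_hom_linear.
  + exact: filMod_hom_linear.
  + by move=> m; rewrite jm f0E.
- apply: filMod_homP => m; have [co [jco _ _]] := je M'.
  by apply: (bc_inj jco (re_inj ext)); rewrite -!jm gg'.
(* [N] and [F M] both extend the same [M]; extending its identity in the two directions gives
   mutually inverse morphisms. *)
have [M [i ie]] := surj N.
have [//|u uP uE] := ext_hom_ext ext (je M) ie (g := id).
  exact: (svalP (filMod_id M)).
have [//|v vP vE] := ext_hom_ext ext ie (je M) (g := id).
  exact: (svalP (filMod_id M)).
exists M, (exist _ u uP), (exist _ v vP); split; apply: filMod_homP.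
  apply: (ext_hom_eq (je M)); [exact: filMod_hom_linear|exact: filMod_hom_linear|].
  by move=> m; rewrite /= uE vE.
apply: (ext_hom_eq ie); [exact: filMod_hom_linear|exact: filMod_hom_linear|].
by move=> m; rewrite /= vE uE.
Qed.

End ScalarExtensionFunctor.

Theorem theorem2p4p2 (p : nat) (p_prime : prime p)
  (k : fieldType) (k_perfect : perfect_of_char p k)
  (W : idomainType) (res : {rmorphism W -> k}) (W_witt : is_witt_ring p res)
  (sigma : {rmorphism W -> W}) (sigma_frob : is_arith_frobenius p res sigma)
  (K : fieldExtType {fraction W}) (e : nat) (K_ram : totally_ramified p K e)
  (pi : K) (pi_unif : uniformizer pi)
  (E : {poly W}) (E_eis : eisenstein_poly_of p pi E)
  (D : comNzRingType) (J : set D) (g : nat -> D -> D)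
  (inc : {rmorphism {poly W} -> D})
  (S : comNzRingType) (cpl : {rmorphism D -> S})
  (S_breuil : is_breuil_ring p E J g inc cpl)
  (phiS : {rmorphism S -> S})
  (phiS_frob : is_frobenius_S p (cpl \o inc) sigma phiS)
  (iota : {rmorphism Sigma p E -> S})
  (iota_incl : is_Sigma_inclusion (cpl \o inc) iota)
  (phiSig : {rmorphism Sigma p E -> Sigma p E})
  (phiSig_frob : forall x, iota (phiSig x) = phiS (iota x))
  (r : nat) (r_le : (r <= p.-1)%N) :
  let FS := FilS p E g inc cpl in
  let SR := FilFrobRing FS phiS (cpl (inc E)) in
  let SigR := FilFrobRing (fun i => iota @^-1` FS i)%classic phiSig
                (toSigma p E (map_poly fpsC E)) in
  (exists F : functor (ModPhi p r SigR) (ModPhi p r SR),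
     is_scalar_extension (iota : SigR -> SR) F) /\
  (forall F : functor (ModPhi p r SigR) (ModPhi p r SR),
     is_scalar_extension (iota : SigR -> SR) F -> equivalence F).
Proof.
move=> FS SR SigR; have [E_eisen _] := E_eis.
have [E_monic sE1 _ _] := E_eisen.
have S_tf := S_torsion_free p_prime W_witt E_monic sE1 S_breuil.
have FSsub := FilS_submod p_prime W_witt E_monic sE1 S_breuil.
have phiF i x := @phi_FilS p p_prime k W res W_witt E E_monic sE1 D J g inc S cpl
  S_breuil sigma phiS phiS_frob iota iota_incl phiSig phiSig_frob E_eisen i x.
have [c [d [cE dc]]] := Sigma_c p_prime W_witt E_monic sE1 phiS_frob iota_incl
  phiSig_frob E_eisen.
have iinj := iota_inj iota_incl.
have iE : iota (tau p E E) = cpl (inc E) := iota_tau iota_incl E.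
have gS : @good_ring p r SR (iota c).
  split=> //.
  - by rewrite /= -iE -phiSig_frob cE rmorphMn.
  - by exists (iota d); rewrite -rmorphM dc rmorph1.
  - exact: FSsub.
  - exact: (FilS_E S_breuil).
  - by move=> s /(phiF r _ r_le)[t tE]; exists (iota t).
have gSig : @good_ring p r SigR c.
  split.
  - exact: (Sigma_torsion_free p_prime W_witt E_monic sE1 S_breuil iota_incl).
  - exact: cE.
  - by exists d.
  - have [F0 Fl] := FSsub r; split=> [|a x y Fx Fy]; first by rewrite /= rmorph0.
    by rewrite /= rmorphD rmorphM; apply: Fl.
  - by rewrite /= rmorphXn iE; apply: (FilS_E S_breuil).
  - move=> s /(phiF r _ r_le)[t tE]; exists t; apply: iinj.
    by rewrite rmorphMn -tE; apply: phiSig_frob.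
have ext : @ring_ext p r SigR SR iota c.
  split=> //.
  - exact: FSsub.
  - by move=> s; apply: (FilSW S_breuil); apply: leq_trans r_le (leq_pred p).
  - exact: (S_Sigma_FilS p_prime W_witt S_breuil iota_incl).
  - exact: (phi_S p_prime W_witt E_monic sE1 S_breuil phiS_frob iota_incl phiSig_frob E_eisen).
  - by move=> x; apply: phiF.
split; first exact: (@scalar_extension_exists p r SigR SR iota c ext).
apply: (@scalar_extension_equivalence p r SigR SR iota c ext) => N.
pose tauS : {rmorphism {poly W} -> SR} := cpl \o inc.
have [_ _ res_surj res_ker] := W_witt.
(* W[u] plays the role of [R]: reducing coefficients maps it onto k[u] with kernel p W[u], and every
   element of S is a polynomial up to Fil^p S and p S. *)
apply: (@ext_along_surj p r SigR SR iota c ext {poly W} k (map_poly res) tauS E).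
- move=> q; have [f fE] := choice res_surj.
  exists (\poly_(i < size q) f q`_i); apply/polyP => i.
  rewrite coef_map coef_poly; case: ltnP => [_|qi]; first exact: fE.
  by rewrite [RHS]nth_default //; apply: rmorph0.
- move=> a a0; have ex i : exists w, a`_i = w *+ p.
    have /res_ker[w wE] : res a`_i = 0 by rewrite -coef_map a0 coef0.
    by exists w; rewrite wE expn1.
  have [w wE] := choice ex; exists (\poly_(i < size a) w i); apply/polyP => i.
  rewrite expn1 coefMn coef_poly; case: ltnP => [_|ai]; first exact: wE.
  by rewrite mul0rn nth_default.
- by [].
- move=> x; have [a [v [x' [xE vp]]]] := S_mod_FilS p_prime S_breuil x.
  by exists a, (cpl v), x'; split=> //; apply: (FilS_cpl S_breuil).
- exact: (Sigma_adic_p E (witt_adic W_witt)).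
- exact: (@padic_adic p S S^o (S_padic S_breuil)).
Qed.
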